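(* Let $n\ge 0$ be an integer. \begin{enumerate} \item[(i)] The residue of the paircrank mod $3$ divides the partition pairs of $3n+2$ from $\widetilde{\mathrm{PP}}$ into $3$ equal classes; that is, for each residue $r$ mod $3$ the number of partition pairs $(\pi_1,\pi_2)\in\widetilde{\mathrm{PP}}$ of $3n+2$ with $\mathrm{paircrank}(\pi_1,\pi_2)\equiv r\pmod 3$ is the same. \item[(ii)] The residue of the paircrank mod $5$ divides the partition pairs of $5n+3$ from $\widetilde{\mathrm{PP}}$ into $5$ equal classes. \item[(iii)] The residue of the paircrank mod $5$ divides the partition pairs of $5n+4$ from $\widetilde{\mathrm{PP}}$ into $5$ equal classes. \end{enumerate}
   Context: A partition of a non-negative integer is a (finite) non-decreasing sequence of positive integers; $|\pi|$ denotes the sum of the parts of $\pi$, $\#(\pi)$ the number of parts, $s(\pi)$ the smallest part and $\ell(\pi)$ the largest part. The empty partition $\emptyset$ has $|\emptyset|=0$, $\#(\emptyset)=0$, $s(\emptyset)=\infty$ and $\ell(\emptyset)=0$. A partition pair of $n$ is an ordered pair of partitions $(\pi_1,\pi_2)$ with $|\pi_1|+|\pi_2|=n$. Let $\widetilde{\mathrm{PP}}$ be the set of all partition pairs $(\pi_1,\pi_2)$ such that $\pi_1\neq\emptyset$, $s(\pi_1)\le s(\pi_2)$ and $\ell(\pi_2)<2s(\pi_1)$ ($\pi_2$ may be empty). For $(\pi_1,\pi_2)\in\widetilde{\mathrm{PP}}$ define $$\mathrm{paircrank}(\pi_1,\pi_2)=\begin{cases}\#(\pi_1)-1 & \text{if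 }\#(\pi_2)=0,\\ (\text{number of parts of }\pi_1\text{ that are}\ge s(\pi_1)+\#(\pi_2))-\#(\pi_2) & \text{if }\#(\pi_2)>0,\end{cases}$$ where parts are counted with multiplicity. *)

(* Defs.v *)
From mathcomp Require Import all_boot all_order all_algebra.

Set Implicit Arguments.
Unset Strict Implicit.
Unset Printing Implicit Defensive.

(* A partition is the non-decreasing sequence of its parts. *)
Definition is_partition (s : seq nat) : bool :=
  sorted leq s && all (fun k => 0 < k) s.

(* The smallest part lives in nat extended by an infinity: [None] stands for
   +oo, the value at the empty partition. *)
Definition smallest (s : seq nat) : option nat := ohead s.

Definition largest (s : seq nat) : nat := last 0 s.

Definition le_inf (x y : option nat) : bool :=
  match x, y with
  | _, None => true
  | None, Some _ => false
  | Some a, Some b => a <= b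
  end.

Definition lt_inf (x y : option nat) : bool := ~~ le_inf y x.

Definition is_pair_of (n : nat) (p : seq nat * seq nat) : bool :=
  [&& is_partition p.1, is_partition p.2 & sumn p.1 + sumn p.2 == n].

Definition in_PPt (p : seq nat * seq nat) : bool :=
  [&& is_partition p.1, is_partition p.2, p.1 != [::],
      le_inf (smallest p.1) (smallest p.2) &
      lt_inf (Some (largest p.2)) (omap (muln 2) (smallest p.1))].

Definition paircrank (p : seq nat * seq nat) : int :=
  if size p.2 == 0 then (Posz (size p.1) - 1)%R
  else
    (Posz (count (fun k => le_inf (omap (addn^~ (size p.2)) (smallest p.1))
                                  (Some k)) p.1)
     - Posz (size p.2))%R.

(* A partition of some m <= n has at most n parts, each of them at most n, so
   the partition pairs of n are found among pairs of sequences of length at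
   most n over 'I_n.+1; see [mem_PPt_pairs] and [uniq_PPt_pairs]. *)
Definition PPt_pairs (n : nat) : seq (seq nat * seq nat) :=
  [seq p <- [seq (map val (val t.1), map val (val t.2)) |
              t : {bseq n of 'I_n.+1} * {bseq n of 'I_n.+1}]
   | is_pair_of n p && in_PPt p].

Definition PPt_count (m : nat) (r : int) (n : nat) : nat :=
  count (fun p => (paircrank p == r %[mod m])%Z) (PPt_pairs n).

Lemma uniq_PPt_pairs n : uniq (PPt_pairs n).
Proof.
apply: filter_uniq; rewrite map_inj_uniq ?enum_uniq //.
case=> a b [c d] /= [/(inj_map val_inj) /val_inj -> /(inj_map val_inj) /val_inj ->].
by [].
Qed.

Lemma partition_bseq n s : is_partition s -> sumn s <= n ->
  exists t : {bseq n of 'I_n.+1}, map val (val t) = s.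
Proof.
case/andP=> _ pos_s le_sn.
have size_s : size s <= n.
  apply: leq_trans le_sn; elim: s pos_s => //= k s IHs /andP[k_gt0 /IHs].
  by move=> le_s; rewrite -add1n leq_add.
have bound_s : all (fun k => k < n.+1) s.
  apply/allP=> k k_s; rewrite ltnS; apply: leq_trans le_sn.
  elim: {pos_s size_s} s k_s => //= j s IHs; rewrite inE.
  case/orP=> [/eqP->|/IHs le_ks]; first exact: leq_addr.
  exact: leq_trans le_ks (leq_addl _ _).
have size_t : size (map inord s : seq 'I_n.+1) <= n by rewrite size_map.
exists (Bseq size_t); rewrite /= -map_comp -[RHS]map_id.
by apply/eq_in_map=> k /(allP bound_s) /= /inordK.
Qed.

Lemma mem_PPt_pairs n p : (p \in PPt_pairs n) = is_pair_of n p && in_PPt p.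
Proof.
rewrite mem_filter andbC; case: (boolP (is_pair_of n p && in_PPt p)) => [|_]; last by rewrite andbF.
case: p => a b /andP[/and3P[/= pa pb /eqP sum_n] _]; rewrite andbT.
have [|t def_a] := partition_bseq (n := n) pa; first by rewrite -sum_n leq_addr.
have [|u def_b] := partition_bseq (n := n) pb; first by rewrite -sum_n leq_addl.
by apply/mapP; exists (t, u); rewrite ?mem_enum //= def_a def_b.
Qed.

(* Main.v *)
(** Put [q = t ^ 6] and let F(z) be the generating function of z^paircrank q^size.
    Sorting the pairs by the smallest part of the first partition and the number
    k of parts of the second one gives
      F(z) = sum_(k, m >= 0) z^(m-k) q^((k+1)(m+1)) / ((q)_k (q)_m (1 - q^(k+m+1))).
    Its diagonals m - k = d satisfy a recurrence d -> d + 4 whose inhomogeneous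
    term is a multiple of sum_k q^(k(k+d)) / ((q)_k (q)_(k+d)) = 1 / (q)_oo, whence
      (q)_oo F(z) = G(z) = sum_(n > 0, m) chi(n) z^m t^(4n^2+2+6n|m|),
    where chi is the nontrivial character modulo 3. With
    theta(z) = sum_i (-1)^i z^i t^(3i(i-1)), sign-reversing involutions show
    G theta = (q)_oo D for a Hecke-type double sum D, so F theta = D.

    If z^3 = 1, then theta is supported on exponents divisible by 18 and D has no
    exponent congruent to 12 modulo 18, so that the coefficient of q^(3n+2) in F
    vanishes. If z^5 = 1, then theta = (1 - z) A + (z^4 - z^2) B with A and B
    supported on exponents congruent to 0 and 1 modulo 5, and D has no exponent
    congruent to 4; this is one linear relation between the components F_3 and
    F_4 of F. A second one comes from a partial fraction identity for quotients
    of theta functions, which relates the components of G. The determinant of the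
    two relations is not zero, hence F_3 = F_4 = 0.

    Finally, the minimal polynomial of a primitive p-th root of unity z is
    1 + X + ... + X^(p-1), so the vanishing of sum_r c_r z^r, where c_r counts
    the pairs of crank r modulo p, forces all the c_r to be equal. *)

From HB Require Import structures.
Require Import Defs.
From mathcomp Require Import all_boot all_order all_algebra all_field.
From mathcomp Require Import boolp classical_sets functions cardinality fsbigop.
From mathcomp Require Import zify ring.

Set Implicit Arguments.
Unset Strict Implicit.
Unset Printing Implicit Defensive.

Import Order.TTheory GRing.Theory Num.Theory.

(** * Formal power series *)

Section PowerSeries.
Local Open Scope ring_scope.
Variable K : numFieldType.

Record fps := Fps { coef_fps :> nat -> K }.

HB.instance Definition _ := gen_eqMixin fps.
HB.instance Definition _ := gen_choiceMixin fps.

Lemma fpsP (f g : fps) : (forall n, f n = g n) -> f = g.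
Proof. by case: f g => f [g] /= fg; congr Fps; apply/funext. Qed.

Definition fps0 := Fps (fun=> 0).
Definition fps1 := Fps (fun n => (n == 0%N)%:R).
Definition fpsD (f g : fps) := Fps (fun n => f n + g n).
Definition fpsN (f : fps) := Fps (fun n => - f n).
Definition fpsM (f g : fps) := Fps (fun n => \sum_(i < n.+1) f i * g (n - i)%N).

Lemma fpsDA : associative fpsD.
Proof. by move=> f g h; apply: fpsP => n; apply: addrA. Qed.

Lemma fpsDC : commutative fpsD.
Proof. by move=> f g; apply: fpsP => n; apply: addrC. Qed.

Lemma fps0D : left_id fps0 fpsD.
Proof. by move=> f; apply: fpsP => n; apply: add0r. Qed.

Lemma fpsND : left_inverse fps0 fpsN fpsD.
Proof. by move=> f; apply: fpsP => n; apply: addNr. Qed.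

HB.instance Definition _ := GRing.isZmodule.Build fps fpsDA fpsDC fps0D fpsND.

(** A coefficient of a product depends only on truncations of the factors, so associativity and
    commutativity are inherited from [{poly K}]. *)
Let trunc n (f : fps) : {poly K} := \poly_(i < n.+1) f i.

Lemma fpsM_trunc m n (f g : fps) : (n <= m)%N ->
  fpsM f g n = (trunc m f * trunc m g)`_n.
Proof.
move=> le_nm; rewrite coefM; apply: eq_bigr => i _.
by rewrite !coef_poly !ltnS (leq_trans _ le_nm) ?(leq_trans (leq_subr _ _) le_nm) // -ltnS.
Qed.

Lemma trunc_fpsM n (f g : fps) i : (i <= n)%N ->
  (trunc n (fpsM f g))`_i = (trunc n f * trunc n g)`_i.
Proof. by move=> le_in; rewrite coef_poly ltnS le_in (fpsM_trunc _ _ le_in). Qed.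

Lemma fpsMC : commutative fpsM.
Proof. by move=> f g; apply: fpsP => n; rewrite !(fpsM_trunc _ _ (leqnn n)) mulrC. Qed.

Lemma coefM_eq (p p' r : {poly K}) n : (forall i, (i <= n)%N -> p`_i = p'`_i) ->
  (p * r)`_n = (p' * r)`_n.
Proof. by move=> pp'; rewrite !coefM; apply: eq_bigr => i _; rewrite pp' // -ltnS. Qed.

Lemma fpsMA : associative fpsM.
Proof.
move=> f g h; apply: fpsP => n; rewrite !(fpsM_trunc _ _ (leqnn n)).
rewrite (coefM_eq _ (@trunc_fpsM n f g)) mulrC.
by rewrite (coefM_eq _ (@trunc_fpsM n g h)) mulrC mulrA.
Qed.

Lemma fps1M : left_id fps1 fpsM.
Proof.
move=> f; apply: fpsP => n; rewrite /= big_ord_recl /= subn0 mul1r big1 ?addr0 // => i _.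
by rewrite mul0r.
Qed.

Lemma fpsMDl : left_distributive fpsM fpsD.
Proof.
move=> f g h; apply: fpsP => n /=; rewrite -big_split; apply: eq_bigr => i _ /=.
by rewrite mulrDl.
Qed.

Lemma fps1_neq0 : fps1 != 0.
Proof. by apply/eqP => /(congr1 (fun f : fps => f 0%N)) /eqP; rewrite oner_eq0. Qed.

HB.instance Definition _ :=
  GRing.Zmodule_isComNzRing.Build fps fpsMA fpsMC fps1M fpsMDl fps1_neq0.

Lemma fps0E n : (0 : fps) n = 0. Proof. by []. Qed.
Lemma fps1E n : (1 : fps) n = (n == 0%N)%:R. Proof. by []. Qed.
Lemma fpsDE (f g : fps) n : (f + g) n = f n + g n. Proof. by []. Qed.
Lemma fpsNE (f : fps) n : (- f) n = - f n. Proof. by []. Qed.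
Lemma fpsBE (f g : fps) n : (f - g) n = f n - g n. Proof. by []. Qed.
Lemma fpsME (f g : fps) n : (f * g) n = \sum_(i < n.+1) f i * g (n - i)%N.
Proof. by []. Qed.

Lemma fps_sumE (I : Type) (r : seq I) (P : pred I) (F : I -> fps) n :
  (\sum_(i <- r | P i) F i) n = \sum_(i <- r | P i) F i n.
Proof. by elim/big_rec2: _ => // i x y _ <-. Qed.

Lemma fps_coef0M (f g : fps) : (f * g) 0%N = f 0%N * g 0%N.
Proof. by rewrite fpsME big_ord1. Qed.

Lemma fpsM_neq0P (f g : fps) n : (f * g) n != 0 ->
  exists i j, [/\ (i + j)%N = n, f i != 0 & g j != 0].
Proof.
move=> fg; have /existsP[i] : [exists i : 'I_n.+1, f i * g (n - i)%N != 0].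
  apply: contraNT fg => /existsPn fg0; rewrite fpsME big1 // => i _.
  by apply/eqP; move: (fg0 i); rewrite negbK.
rewrite mulf_eq0 negb_or => /andP[fi gi]; exists (nat_of_ord i), (n - i)%N; split=> //.
by have := ltn_ord i; lia.
Qed.

(** If [a] is the order of [f] and [g] vanishes below [n], then coefficient [a + n] of the product
    is [f a * g n]. Later divisions by theta-like factors are cancellations of this kind. *)
Lemma fps_mulf_eq0 (f g : fps) : f * g = 0 -> f != 0 -> g = 0.
Proof.
move=> fg0 f0; have exf : exists n, f n != 0.
  apply: contrapT => /forallNP fn0; move/eqP: f0; apply; apply: fpsP => n.
  by apply/eqP/negPn/negP/fn0.
have [a fa min_a] := ex_minnP exf.
apply: fpsP => n; elim/ltn_ind: n => n IHn.
have := congr1 (fun h : fps => h (a + n)%N) fg0; rewrite fpsME => /eqP.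
have lt_a : (a < (a + n).+1)%N by rewrite ltnS leq_addr.
rewrite (bigD1 (Ordinal lt_a)) //= big1 => [|i]; last first.
  rewrite -val_eqE /= neq_ltn => /orP[lt_ia|lt_ai].
    suff -> : f i = 0 by rewrite mul0r.
    by apply/eqP; apply: contraTT lt_ia => /min_a; rewrite -leqNgt.
  rewrite IHn ?mulr0 //; have := ltn_ord i; lia.
by rewrite addr0 addKn mulf_eq0 (negPf fa) /= => /eqP.
Qed.

Lemma fps_unit_neq0 (f : fps) : f 0%N != 0 -> f != 0.
Proof. by apply: contraNneq => ->. Qed.

(* [mono c e] is [0] when the exponent [e] is negative. *)
Definition mono (c : K) (e : int) : fps :=
  Fps (fun n => if n%:Z == e then c else 0).

Lemma mono0 e : mono 0 e = 0.
Proof. by apply: fpsP => n /=; case: ifP. Qed.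

Lemma mono1 : mono 1 0 = 1.
Proof. by apply: fpsP => n; rewrite fps1E /= eqz_nat; case: (n == 0%N). Qed.

Lemma monoN c e : mono (- c) e = - mono c e.
Proof. by apply: fpsP => n /=; case: ifP; rewrite ?oppr0. Qed.

Lemma monoD c c' e : mono (c + c') e = mono c e + mono c' e.
Proof. by apply: fpsP => n; rewrite fpsDE /=; case: ifP; rewrite ?addr0. Qed.

Lemma monoM c c' e e' : 0 <= e -> 0 <= e' ->
  mono c e * mono c' e' = mono (c * c') (e + e').
Proof.
case: e e' => [e|//] [e'|//] _ _; apply: fpsP => n; rewrite fpsME /=.
have [le_en|lt_ne] := leqP e n; last first.
  rewrite big1 => [|i _]; first by case: eqP => // ?; exfalso; lia.
  by case: eqP => [?|]; rewrite ?mul0r //; have := ltn_ord i; lia.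
have lt_e : (e < n.+1)%N by [].
rewrite (bigD1 (Ordinal lt_e)) //= eqxx big1 ?addr0 => [|i]; last first.
  by rewrite -val_eqE /= eqz_nat => /negPf ->; rewrite mul0r.
have -> : ((n - e)%N%:Z == e') = (n%:Z == e%:Z + e'%:Z) by lia.
by case: ifP; rewrite ?mulr0.
Qed.

Lemma mono_neq0P c e n : (mono c e) n != 0 -> c != 0 /\ n%:Z = e.
Proof. by rewrite /=; case: ifP => [/eqP -> ->|_ /eqP]. Qed.

End PowerSeries.

(** * Coefficientwise sums *)

Section Summation.
Local Open Scope ring_scope.
Variable K : numFieldType.
Local Notation fps := (fps K).

(* [Sum f] is the coefficientwise sum of a family of power series; it is
   meaningful when [smb f] holds, that is when each coefficient vanishes outside
   of a finite set of indices. *)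
Definition smb (I : choiceType) (f : I -> fps) :=
  forall N, exists r : seq I, forall i, i \notin r -> f i N = 0.

Fact Sum_key : unit. Proof. by []. Qed.
Definition Sum (I : choiceType) (f : I -> fps) : fps :=
  locked_with Sum_key (Fps (fun n => (\sum_(i \in [set: I]) f i n)%R)).

Lemma Sum_coef (I : choiceType) (f : I -> fps) n :
  Sum f n = (\sum_(i \in [set: I]) f i n)%R.
Proof. by rewrite /Sum [locked_with Sum_key _]unlock. Qed.

Lemma SumE (I : choiceType) (f : I -> fps) (r : seq I) n : uniq r ->
  (forall i, i \notin r -> f i n = 0) -> Sum f n = \sum_(i <- r) f i n.
Proof.
move=> ur fr; rewrite Sum_coef (fsbigE r) //=; last by move=> i _ /fr.
by apply: eq_bigl => i; rewrite in_setT.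
Qed.

Lemma SumE_seq (I : choiceType) (f : I -> fps) (n : nat) : smb f ->
  exists2 r : seq I, uniq r & forall i, i \notin r -> f i n = 0.
Proof. by case/(_ n) => r fr; exists (undup r); rewrite ?undup_uniq // => i; rewrite mem_undup => /fr. Qed.

Lemma eq_Sum (I : choiceType) (f g : I -> fps) : f =1 g -> Sum f = Sum g.
Proof. by move=> fg; congr Sum; apply/funext. Qed.

Lemma smb_sub (I : choiceType) (f g : I -> fps) :
  smb f -> (forall i n, g i n != 0 -> f i n != 0) -> smb g.
Proof.
move=> sf gf N; have [r fr] := sf N; exists r => i /fr fi0.
by apply/eqP/negPn/negP => /gf; rewrite fi0 eqxx.
Qed.

Lemma smbD (I : choiceType) (f g : I -> fps) : smb f -> smb g ->
  smb (fun i => f i + g i).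
Proof.
move=> sf sg N; have [r fr] := sf N; have [s gs] := sg N; exists (r ++ s) => i.
by rewrite mem_cat negb_or => /andP[/fr fi /gs gi]; rewrite fpsDE fi gi addr0.
Qed.

Lemma smbN (I : choiceType) (f : I -> fps) : smb f -> smb (fun i => - f i).
Proof. by move=> sf; apply: (smb_sub sf) => i n; rewrite fpsNE oppr_eq0. Qed.

Lemma smbB (I : choiceType) (f g : I -> fps) : smb f -> smb g ->
  smb (fun i => f i - g i).
Proof. by move=> sf sg; apply: smbD => //; apply: smbN. Qed.

Lemma SumD (I : choiceType) (f g : I -> fps) : smb f -> smb g ->
  Sum (fun i => f i + g i) = Sum f + Sum g.
Proof.
move=> sf sg; apply: fpsP => n; rewrite fpsDE.
have [r ur fr] := SumE_seq n sf; have [s us gs] := SumE_seq n sg.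
have out i : i \notin undup (r ++ s) -> f i n = 0 /\ g i n = 0.
  by rewrite mem_undup mem_cat negb_or => /andP[/fr ? /gs].
have u := undup_uniq (r ++ s).
rewrite !(SumE u) ?big_split //= => i /out[fi gi] //.
by rewrite fi gi addr0.
Qed.

Lemma SumN (I : choiceType) (f : I -> fps) : smb f ->
  Sum (fun i => - f i) = - Sum f.
Proof.
move=> sf; apply: fpsP => n; have [r ur fr] := SumE_seq n sf.
rewrite fpsNE !(SumE ur) // => [|i /fr]; last by rewrite fpsNE => ->; rewrite oppr0.
by rewrite -sumrN.
Qed.

Lemma SumB (I : choiceType) (f g : I -> fps) : smb f -> smb g ->
  Sum (fun i => f i - g i) = Sum f - Sum g.
Proof. by move=> sf sg; rewrite SumD ?SumN //; apply: smbN. Qed.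

Lemma Sum0 (I : choiceType) : Sum (fun _ : I => 0) = 0.
Proof. by apply: fpsP => n; rewrite (@SumE _ _ [::]) ?big_nil. Qed.

Lemma Sum_eq0 (I : choiceType) (f : I -> fps) : (forall i, f i = 0) -> Sum f = 0.
Proof. by move=> f0; rewrite -(Sum0 I); apply: eq_Sum. Qed.

(** A coefficient of a product involves all lower coefficients of the factors, so one finite index
    set has to serve for all of them up to [N]. *)
Lemma smb_le (I : choiceType) (f : I -> fps) (N : nat) : smb f ->
  exists2 r : seq I, uniq r &
    forall n i, (n <= N)%N -> i \notin r -> f i n = 0.
Proof.
move=> sf; elim: N => [|N [r ur rP]].
  have [r ur rP] := SumE_seq 0 sf; exists r => // n i.
  by rewrite leqn0 => /eqP ->; apply: rP.
have [s us sP] := SumE_seq N.+1 sf.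
exists (undup (r ++ s)); rewrite ?undup_uniq // => n i.
rewrite mem_undup mem_cat negb_or leq_eqVlt ltnS => /orP[/eqP->|le_n] /andP[ir is'].
  exact: sP.
exact: rP.
Qed.

Lemma smb_mull (I : choiceType) (c : fps) (f : I -> fps) : smb f ->
  smb (fun i => c * f i).
Proof.
move=> sf N; have [r _ rP] := smb_le N sf.
exists r => i ir; rewrite fpsME big1 // => j _.
by rewrite (rP _ _ _ ir) ?mulr0 // leq_subr.
Qed.

Lemma Sum_mull (I : choiceType) (c : fps) (f : I -> fps) : smb f ->
  c * Sum f = Sum (fun i => c * f i).
Proof.
move=> sf; apply: fpsP => n; have [r ur rP] := smb_le n sf.
rewrite fpsME (SumE ur) => [|i ir]; last first.
  by rewrite fpsME big1 // => j _; rewrite (rP _ _ _ ir) ?mulr0 // leq_subr.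
under [RHS]eq_bigr do rewrite fpsME.
rewrite exchange_big /=; apply: eq_bigr => j _.
by rewrite (SumE ur) ?mulr_sumr // => i ir; rewrite (rP _ _ _ ir) // leq_subr.
Qed.

Lemma Sum_mulr (I : choiceType) (c : fps) (f : I -> fps) : smb f ->
  Sum f * c = Sum (fun i => f i * c).
Proof. by move=> sf; rewrite mulrC Sum_mull //; apply: eq_Sum => i; rewrite mulrC. Qed.

Lemma smb_reindex (I J : choiceType) (h : I -> J) (f : J -> fps) :
  injective h -> smb f -> smb (fun i => f (h i)).
Proof.
move=> inj_h sf N; have [r fr] := sf N.
(* A choice of preimages under [h], which pulls the finite support back. *)
pose g j := if pselect (exists i, h i = j) is left e then Some (projT1 (cid e)) else None.
exists (pmap g r) => i; apply: contraNeq => fhi.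
have : h i \in r by apply: contraNT fhi => /fr ->.
rewrite mem_pmap => hr; apply/mapP; exists (h i) => //.
rewrite /g; case: pselect => [e|[]]; last by exists i.
by case: cid => i' /= /inj_h ->.
Qed.

Lemma Sum_reindex (I J : choiceType) (h : I -> J) (f : J -> fps) :
  injective h -> (forall j, f j != 0 -> exists i, h i = j) ->
  Sum f = Sum (fun i => f (h i)).
Proof.
move=> inj_h sup; apply: fpsP => n; rewrite !Sum_coef.
transitivity (\sum_(j \in range h) f j n)%R.
  apply/esym/fsbig_widen => // j [_ nj] /=; apply/eqP/negPn/negP => fj; apply: nj.
  have [|i <-] := sup j; last by exists i.
  by apply: contraNneq fj => ->.
apply: reindex_fsbig; split=> [i _|i i' _ _ /inj_h //|j [i _ <-]]; by exists i.
Qed.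

(** Reindexing by [h] gives [Sum f = - Sum f], and 2 is nonzero in [K]. Fixed points of [h] do no
    harm: their terms are their own opposites. *)
Lemma Sum_invol (I : choiceType) (h : I -> I) (f : I -> fps) :
  involutive h -> smb f -> (forall i, f (h i) = - f i) -> Sum f = 0.
Proof.
move=> hK sf fh; have : Sum f = - Sum f.
  rewrite -SumN // (@Sum_reindex _ _ h); first exact: eq_Sum.
    exact: inv_inj.
  by move=> j _; exists (h j); rewrite hK.
move/eqP; rewrite -subr_eq0 opprK => /eqP S0; apply: fpsP => n.
have /eqP := congr1 (fun g : fps => g n) S0; rewrite fpsDE fps0E -mulr2n.
by rewrite mulrn_eq0 /= => /eqP.
Qed.

Lemma smb_row (I J : choiceType) (f : I * J -> fps) i : smb f ->
  smb (fun j => f (i, j)).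
Proof. by move=> sf; apply: (smb_reindex _ sf) => j j' []. Qed.

Lemma smb_pair (I J : choiceType) (f : I * J -> fps) : smb f ->
  smb (fun i => Sum (fun j => f (i, j))).
Proof.
move=> sf N; have [r fr] := sf N; exists (map fst r) => i ir.
rewrite (@SumE _ _ [::]) ?big_nil // => j _; apply: fr.
by apply: contra ir => /(map_f fst).
Qed.

Lemma Sum_pair (I J : choiceType) (f : I * J -> fps) : smb f ->
  Sum f = Sum (fun i => Sum (fun j => f (i, j))).
Proof.
move=> sf; apply: fpsP => n; have [r fr] := sf n.
pose a := undup (map fst r); pose b := undup (map snd r).
have out i j : (i \notin a) || (j \notin b) -> f (i, j) n = 0.
  rewrite !mem_undup => ij; apply: fr; move: ij; apply: contraTN => ijr.
  by rewrite (map_f fst ijr) (map_f snd ijr).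
rewrite (@SumE _ _ [seq (i, j) | i <- a, j <- b]) => [||[i j] ij]; last 2 first.
- by apply: allpairs_uniq; rewrite ?undup_uniq // => -[? ?] [? ?] _ _ [-> ->].
- apply: out; rewrite -negb_and; apply: contra ij => /andP[ia jb].
  exact: allpairs_f.
rewrite big_allpairs (@SumE _ _ a) ?undup_uniq // => [|i ia].
  by apply: eq_bigr => i _; rewrite (@SumE _ _ b) ?undup_uniq // => j jb; apply: out; rewrite jb orbT.
by rewrite (@SumE _ _ [::]) ?big_nil // => j _; apply: out; rewrite ia.
Qed.

Lemma smb_prod (I J : choiceType) (f : I -> fps) (g : J -> fps) : smb f -> smb g ->
  smb (fun ij : I * J => f ij.1 * g ij.2).
Proof.
move=> sf sg N.
have [r _ rP] := smb_le N sf; have [s _ sP] := smb_le N sg.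
exists [seq (i, j) | i <- r, j <- s] => -[i j]; apply: contraNeq => /fpsM_neq0P[m [n [mn fi gj]]].
by apply: allpairs_f; [apply: contraNT fi => ?; rewrite (rP m) |
  apply: contraNT gj => ?; rewrite (sP n)] => //; lia.
Qed.

Lemma Sum_prod (I J : choiceType) (f : I -> fps) (g : J -> fps) : smb f -> smb g ->
  Sum f * Sum g = Sum (fun ij : I * J => f ij.1 * g ij.2).
Proof.
move=> sf sg; rewrite Sum_pair ?Sum_mulr //=; last exact: smb_prod.
by apply: eq_Sum => i; rewrite Sum_mull.
Qed.

Lemma Sum_partition (I : choiceType) (m : nat) (k : I -> nat) (f : I -> fps) :
  smb f -> (forall i, k i < m)%N ->
  Sum f = \sum_(c < m) Sum (fun i => if k i == c then f i else 0).
Proof.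
move=> sf km; apply: fpsP => n; rewrite fps_sumE.
have [r ur fr] := SumE_seq n sf; rewrite (SumE ur fr).
under [RHS]eq_bigr => c _.
  rewrite (SumE ur) => [|i /fr fi]; last by case: ifP.
  over.
rewrite exchange_big /=; apply: eq_bigr => i _.
rewrite (bigD1 (Ordinal (km i))) //= eqxx big1 ?addr0 // => c.
by rewrite -val_eqE /= eq_sym => /negPf ->.
Qed.

Lemma Sum_single (I : choiceType) (i0 : I) (f : I -> fps) :
  (forall i, i != i0 -> f i = 0) -> Sum f = f i0.
Proof.
move=> f0; apply: fpsP => n; rewrite (@SumE _ _ [:: i0]) ?big_seq1 // => i.
by rewrite inE => /f0 ->.
Qed.

Lemma Sum_natS (f : nat -> fps) : smb f ->
  Sum f = f 0%N + Sum (fun n => f n.+1).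
Proof.
move=> sf; rewrite (@Sum_partition _ 2 (fun i => (0 < i)%N) f) => [|//|i]; last by case: i.
rewrite !big_ord_recl big_ord0 addr0 /=; congr (_ + _).
  by rewrite (@Sum_single _ 0%N) //; case.
rewrite (@Sum_reindex _ _ S) //; first exact: succn_inj.
by case=> [/eqP //|i _]; exists i.
Qed.

End Summation.

(** * Signs and graded components *)

(** A size with finite balls. A family is summable once the size of each index is bounded linearly
    by the exponents that it contributes, see [smb_nrm]. The list [ball] may exceed the true
    ball. *)
Class normed (I : choiceType) := Normed {
  nrm : I -> nat;
  ball : nat -> seq I;
  in_ball : forall M i, nrm i <= M -> i \in ball M }.

#[export] Instance nat_normed : normed nat.
Proof. by exists id (fun M => iota 0 M.+1) => M i; rewrite mem_iota. Defined.

#[export] Instance int_normed : normed int.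
Proof.
exists absz (fun M => map Posz (iota 0 M.+1) ++ map Negz (iota 0 M.+1)) => M i le_iM.
rewrite mem_cat; case: i le_iM => i le_iM; apply/orP.
  by left; apply: (map_f Posz); rewrite mem_iota.
by right; apply: (map_f Negz); rewrite mem_iota /= add0n ltnS ltnW.
Defined.

#[export] Instance prod_normed (I J : choiceType) (NI : normed I) (NJ : normed J) :
  normed (I * J)%type.
Proof.
exists (fun ij => nrm ij.1 + nrm ij.2) (fun M => [seq (i, j) | i <- ball M, j <- ball M]).
by move=> M [i j] /= le_M; apply: allpairs_f; apply: in_ball; lia.
Defined.

Section Basics.
Local Open Scope ring_scope.
Variable K : numFieldType.
Local Notation fps := (fps K).

Lemma smb_nrm (I : choiceType) (NI : normed I) (k C : nat) (f : I -> fps) :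
  (forall i n, f i n != 0 -> (nrm i <= k * n + C)%N) -> smb f.
Proof.
move=> fP N; exists (ball (k * N + C)%N) => i; apply: contraNeq => /fP.
exact: in_ball.
Qed.

Lemma smb_mono (I : choiceType) (NI : normed I) (k C : nat) (c : I -> K) (e : I -> int) :
  (forall i, c i != 0 -> (nrm i)%:Z <= k%:Z * e i + C%:Z) ->
  smb (fun i => mono (c i) (e i)).
Proof.
move=> cP; apply: (@smb_nrm _ _ k C) => i n /mono_neq0P[/cP le_i ne].
by rewrite -lez_nat PoszD PoszM ne.
Qed.

Definition eps (n : int) : K := if (n %% 2)%Z == 0 then 1 else -1.
Definition chi (n : int) : K :=
  if (n %% 3)%Z == 0 then 0 else if (n %% 3)%Z == 1 then 1 else -1.

Lemma eq_eps m n : (m %% 2)%Z = (n %% 2)%Z -> eps m = eps n.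
Proof. by rewrite /eps => ->. Qed.

Lemma epsNN m n : (m %% 2)%Z = ((n + 1) %% 2)%Z -> eps m = - eps n.
Proof.
rewrite /eps => ->; case: (eqVneq (n %% 2)%Z 0) => n2.
  by rewrite ifF //; apply/negbTE; lia.
by rewrite ifT ?opprK //; lia.
Qed.

Lemma epsD m n : eps (m + n) = eps m * eps n.
Proof.
case: (eqVneq (n %% 2)%Z 0) => n2.
  by rewrite (@eq_eps _ m) ?{3}/eps ?n2 ?mulr1 //; lia.
rewrite (@epsNN _ m) ?{3}/eps ?(negPf n2) ?mulrN1 //; lia.
Qed.

Lemma eps_sqr n : eps n * eps n = 1.
Proof. by rewrite /eps; case: ifP; rewrite ?mulrNN mulr1. Qed.

Lemma eps_neq0 n : eps n != 0.
Proof. by rewrite /eps; case: ifP; rewrite ?oppr_eq0 oner_eq0. Qed.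

Lemma eq_chi m n : (m %% 3)%Z = (n %% 3)%Z -> chi m = chi n.
Proof. by rewrite /chi => ->. Qed.

Lemma chiNN m n : (m %% 3)%Z = ((- n) %% 3)%Z -> chi m = - chi n.
Proof.
rewrite /chi => ->; case: (eqVneq (n %% 3)%Z 0) => n0; first by rewrite ifT ?oppr0 //; lia.
rewrite ifF; last by apply/negbTE; lia.
case: (eqVneq (n %% 3)%Z 1) => n1; first by rewrite ifF //; apply/negbTE; lia.
by rewrite ifT ?opprK //; lia.
Qed.

Lemma chi_neq0 n : chi n != 0 -> (n %% 3)%Z != 0.
Proof. by rewrite /chi; case: (eqVneq (n %% 3)%Z 0); rewrite ?eqxx. Qed.

Definition graded (M e : nat) (f : fps) := forall n, f n != 0 -> n = e %[mod M].
Definition component (M e : nat) (f : fps) : fps :=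
  Fps (fun n => if (n %% M == e %% M)%N then f n else 0).

Lemma componentE M e f n : component M e f n = if (n %% M == e %% M)%N then f n else 0.
Proof. by []. Qed.

Lemma componentD M e f g : component M e (f + g) = component M e f + component M e g.
Proof. by apply: fpsP => n; rewrite fpsDE !componentE; case: ifP; rewrite ?addr0. Qed.

Lemma component0 M e : component M e 0 = 0.
Proof. by apply: fpsP => n; rewrite componentE; case: ifP. Qed.

Lemma component_sum M e (I : Type) (r : seq I) (P : pred I) (F : I -> fps) :
  component M e (\sum_(i <- r | P i) F i) = \sum_(i <- r | P i) component M e (F i).
Proof. by exact: (big_morph (component M e) (@componentD M e) (@component0 M e)). Qed.

Lemma component_graded M e f : graded M e f -> component M e f = f.
Proof.
move=> hf; apply: fpsP => n; rewrite componentE; case: eqP => // ne.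
by apply/esym/eqP/negPn/negP => /hf.
Qed.

Lemma component_graded0 M e e' f : graded M e' f -> (e' %% M != e %% M)%N -> component M e f = 0.
Proof.
move=> hf ne; apply: fpsP => n; rewrite componentE; case: eqP => // en.
by apply/eqP; apply: contraNT ne => /hf <-; rewrite en.
Qed.

Lemma eq_graded M e e' f : (e = e' %[mod M])%N -> graded M e f -> graded M e' f.
Proof. by move=> ee hf n /hf ->. Qed.

Lemma eq_component M e e' f : (e = e' %[mod M])%N -> component M e f = component M e' f.
Proof. by move=> ee; apply: fpsP => n; rewrite !componentE ee. Qed.

Lemma graded0 M e : graded M e 0.
Proof. by move=> n; rewrite fps0E eqxx. Qed.

Lemma gradedD M e f g : graded M e f -> graded M e g -> graded M e (f + g).
Proof.
move=> hf hg n; rewrite fpsDE => fg.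
have [f0|/hf //] := eqVneq (f n) 0; apply: hg.
by rewrite f0 add0r in fg.
Qed.

Lemma gradedM M e e' f g : graded M e f -> graded M e' g -> graded M (e + e') (f * g).
Proof.
by move=> hf hg n /fpsM_neq0P[i [j [<- /hf fi /hg gj]]]; rewrite -modnDm fi gj modnDm.
Qed.

Lemma graded_Sum M e (I : choiceType) (f : I -> fps) : smb f ->
  (forall i, graded M e (f i)) -> graded M e (Sum f).
Proof.
move=> sf hf n; have [r ur fr] := SumE_seq n sf; rewrite (SumE ur fr) => S0.
suff /hasP[i _ /hf] : has (fun i => f i n != 0) r by [].
by apply: contraNT S0 => /hasPn f0; rewrite big_seq big1 // => i /f0/negPn/eqP.
Qed.

Lemma graded_mono M e c (x : int) : (c != 0 -> (x %% M%:Z)%Z = (e%:Z %% M%:Z)%Z) ->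
  graded M e (mono c x).
Proof.
move=> xe n /mono_neq0P[/xe + nx]; rewrite -nx !modz_nat => -[]; exact.
Qed.

Lemma graded_const M c : graded M 0 (mono c 0).
Proof. by apply: graded_mono. Qed.

(** A factor whose exponents lie in a single class only shifts the classes of the other factor; this
    is how components are read off products with theta series. *)
Lemma component_mulr M e c f g : (0 < M)%N -> graded M c g ->
  component M (e + c) (f * g) = component M e f * g.
Proof.
move=> M0 hg; apply: fpsP => n; rewrite componentE !fpsME.
case: ifP => [/eqP nec|/negbT nec]; last first.
  apply/esym/big1 => i _; rewrite componentE; case: eqP => [ie|_]; last by rewrite mul0r.
  have [->|/hg gn] := eqVneq (g (n - i)%N) 0; first by rewrite mulr0.
  case/negP: nec; rewrite -(subnK (n := n) (m := i)) -1?ltnS // -modnDm gn ie modnDm.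
  by rewrite addnC.
apply: eq_bigr => i _; rewrite componentE; case: eqP => // ie; rewrite mul0r.
have [->|/hg gn] := eqVneq (g (n - i)%N) 0; first by rewrite mulr0.
case: ie; apply/eqP; rewrite -(eqn_modDr c) -(eqP (introT eqP nec)).
rewrite -{2}(subnK (n := n) (m := i)) -1?ltnS // addnC -modnDml -gn modnDml.
by [].
Qed.

(** Iteration makes [x s] a multiple of [x (s + k)], whose order is at least [s + k], for every
    [k]. *)
Lemma fps_recur_eq0 (x c : nat -> fps) :
  (forall s, x s = c s * x s.+1) -> (forall s n, (n < s)%N -> x s n = 0) ->
  forall s, x s = 0.
Proof.
move=> xc x0 s; apply: fpsP => n; rewrite fps0E.
have [k] : exists k, (n < s + k)%N by exists n.+1; lia.
elim: k s n => [|k IHk] s n lt_n; first by apply: x0; lia.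
rewrite xc fpsME big1 // => i _; rewrite IHk ?mulr0 //; have := ltn_ord i; lia.
Qed.

End Basics.

(** * Theta series and partial fractions *)

Section PartialFractions.
Local Open Scope ring_scope.
Variable K : numFieldType.
Local Notation fps := (fps K).
Local Notation eps := (eps K).
Local Notation chi := (chi K).
Local Notation mono := (@mono K).

Lemma absz_consec (a : int) : (absz a)%:Z <= a * (a - 1) + 1.
Proof. nia. Qed.

Lemma abs_sqr (a : int) (k : nat) : k%:Z * (absz a)%:Z <= a ^+ 2 + (k * k)%:Z.
Proof. nia. Qed.

Lemma consec_ge0 (a : int) : 0 <= a * (a - 1).
Proof. nia. Qed.

Lemma smb_monoM (I : choiceType) (NI : normed I) (k C : nat) (c : I -> K)
    (e : I -> int) (g : I -> fps) :
  (forall i, c i != 0 -> (nrm i)%:Z <= k%:Z * e i + C%:Z) ->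
  smb (fun i => mono (c i) (e i) * g i).
Proof.
move=> cP; apply: (@smb_nrm _ _ _ k C) => i n /fpsM_neq0P[p [r [<- /mono_neq0P[/cP le_i pe] _]]].
by rewrite -lez_nat; lia.
Qed.

(** The terms of [theta] whose index is [rho] modulo 5, stripped of their powers of [z]. *)
Definition theta5 (rho : int) : fps :=
  Sum (fun x : int => mono (eps (5 * x + rho)) (3 * ((5 * x + rho) * (5 * x + rho - 1)))).

Lemma smb_theta5 rho :
  smb (fun x : int => mono (eps (5 * x + rho)) (3 * ((5 * x + rho) * (5 * x + rho - 1)))).
Proof.
apply: (@smb_mono _ _ _ 1 (1 + absz rho)) => x _ /=.
have := absz_consec (5 * x + rho); lia.
Qed.

Lemma theta5_period rho k : theta5 (rho + 5 * k) = theta5 rho.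
Proof.
rewrite /theta5 (@Sum_reindex _ _ _ (fun x : int => x - k)) => [|x y|x _].
- apply: eq_Sum => x; congr mono; first by congr (eps _); ring.
  by ring.
- exact: addIr.
- by exists (x + k); ring.
Qed.

Lemma theta5_opp rho : theta5 (1 - rho) = - theta5 rho.
Proof.
rewrite /theta5 (@Sum_reindex _ _ _ (fun x : int => - x)) => [|x y|x _].
- rewrite -SumN; last exact: smb_theta5.
  apply: eq_Sum => x; rewrite -monoN; congr mono; last by ring.
  by apply: epsNN; lia.
- exact: oppr_inj.
- by exists (- x); rewrite opprK.
Qed.

(* The product (q ^ 5)_oo. *)
Definition Eul5 : fps := Sum (fun a : int => mono (eps a) (15 * ((a - 1) * (3 * a - 2)))).

Lemma smb_Eul5 : smb (fun a : int => mono (eps a) (15 * ((a - 1) * (3 * a - 2)))).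
Proof. by apply: (@smb_mono _ _ _ 1 15) => a _ /=; have := absz_consec a; lia. Qed.

Lemma Eul5_exp_ge0 (a : int) : 0 <= 15 * ((a - 1) * (3 * a - 2)).
Proof. by case: (leP 1 a) => a1; nia. Qed.

Lemma Eul5_neq0 : Eul5 != 0.
Proof.
apply: fps_unit_neq0; rewrite (@SumE _ _ _ [:: 1%Z]) // => [|a].
  by rewrite big_seq1 /= eps_neq0.
rewrite inE => a1; apply/eqP; apply: contraNT a1 => /mono_neq0P[_ /=]; nia.
Qed.

Lemma smb_Eul5_shift (n : int) :
  smb (fun a : int => mono (eps a) (5 * ((3 * a - n - 1) * (3 * a - n - 2)))).
Proof.
apply: (@smb_mono _ _ _ 1 (3 + absz n)) => a _ /=.
have := absz_consec (3 * a - n - 1); nia.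
Qed.

(* The left-hand side is, up to a monomial, a theta function evaluated at a power
   of its nome: it vanishes or reduces to [Eul5] according to [n] modulo 3. *)
Lemma Eul5_shift (n : int) :
  Sum (fun a : int => mono (eps a) (5 * ((3 * a - n - 1) * (3 * a - n - 2)))) =
  - (mono (chi n * eps n) 0 * Eul5).
Proof.
have shift (m k : int) : n = 3 * k + m ->
    Sum (fun a : int => mono (eps a) (5 * ((3 * a - n - 1) * (3 * a - n - 2)))) =
    Sum (fun a : int => mono (eps (a + k)) (5 * ((3 * a - m - 1) * (3 * a - m - 2)))).
  move=> ->; rewrite (@Sum_reindex _ _ _ (fun a : int => a + k)) => [|x y|x _].
  - by apply: eq_Sum => a; congr mono; ring.
  - exact: addIr.
  - by exists (x - k); ring.
have [k [n0|[n1|n2]]] : exists k : int, n = 3 * k \/ n = 3 * k + 1 \/ n = 3 * k + 2.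
  by exists (n %/ 3)%Z; lia.
- have -> : chi n = 0 by rewrite /chi n0 ifT //; lia.
  rewrite mul0r mono0 mul0r oppr0 (shift 0 k) ?n0 ?addr0 //.
  apply: (@Sum_invol _ _ (fun a : int => 1 - a)) => [a||a]; first by ring.
    by apply: (@smb_mono _ _ _ 1 10) => a _ /=; have := absz_consec (3 * a - 0 - 1); lia.
  rewrite -monoN; congr mono; last by ring.
  by apply: epsNN; lia.
- have -> : chi n = 1 by rewrite /chi n1 ifF ?ifT //; lia.
  rewrite (shift 1 k) // mul1r Sum_mull; last exact: smb_Eul5.
  rewrite -SumN; last by apply: smb_mull; apply: smb_Eul5.
  apply: eq_Sum => a; rewrite monoM //; last exact: Eul5_exp_ge0.
  rewrite -monoN add0r; congr mono; last by ring.
  rewrite -epsD; apply: epsNN; lia.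
- have -> : chi n = -1 by rewrite /chi n2 ifF ?ifF //; lia.
  rewrite (shift 2 k) // mulN1r monoN mulNr opprK Sum_mull; last exact: smb_Eul5.
  rewrite (@Sum_reindex _ _ _ (fun a : int => 2 - a)) => [|x y|x _].
  - apply: eq_Sum => a; rewrite monoM //; last exact: Eul5_exp_ge0.
    rewrite add0r; congr mono; last by ring.
    rewrite -epsD; apply: eq_eps; lia.
  - by move=> /(congr1 (fun z => 2 - z)); rewrite !subKr.
  - by exists (2 - x); ring.
Qed.

Lemma mono_mul_Sum3 (c : K) (e : int) (f g h : int -> K) (p r s : int -> int) :
  smb (fun a => mono (f a) (p a)) -> smb (fun a => mono (g a) (r a)) ->
  smb (fun a => mono (h a) (s a)) -> (c != 0 -> 0 <= e) ->
  (forall a, 0 <= p a) -> (forall a, 0 <= r a) -> (forall a, 0 <= s a) ->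
  mono c e * (Sum (fun a => mono (f a) (p a)) * (Sum (fun a => mono (g a) (r a)) *
              Sum (fun a => mono (h a) (s a)))) =
  Sum (fun u : int * (int * int) =>
    mono (c * (f u.1 * (g u.2.1 * h u.2.2))) (e + (p u.1 + (r u.2.1 + s u.2.2)))).
Proof.
move=> sf sg sh ce p0 r0 s0; rewrite (Sum_prod sg sh) (Sum_prod sf (smb_prod sg sh)).
rewrite Sum_mull; last exact: (smb_prod sf (smb_prod sg sh)).
apply: eq_Sum => -[a [x w]] /=.
have [-> | c0] := eqVneq c 0; first by rewrite !mul0r !mono0 mul0r.
by rewrite !monoM ?addr_ge0 ?ce.
Qed.

(** * Products of three theta series *)

Section Expansion.
Variables al be : int.

(** The part of the exponent in [theta5_expand] that is free of [n]; its quadratic form is diagonal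
    in the three indices. *)
Definition Uexp (u : int * (int * int)) : int :=
  45 * (u.1 * (u.1 - 1)) + 75 * (u.2.1 * (u.2.1 - 1)) + 75 * (u.2.2 * (u.2.2 - 1))
  + 30 * al * u.2.1 + 30 * be * u.2.2 + 48 + 3 * al ^+ 2 + 3 * be ^+ 2 - 15 * al - 15 * be.

Definition usum (u : int * (int * int)) : int := u.1 + u.2.1 + u.2.2.

(** By [Eul5_shift], the product of [Eul5] and [chi n] is a third theta sum. In the resulting triple
    sum [n] interacts with the indices only through [usum], which makes reflections in [n]
    available. *)
Lemma theta5_expand (n d : int) (c : K) :
  (c != 0 -> 0 <= 4 * n ^+ 2 + 2 + 6 * (al + be) * n + d) ->
  Eul5 * (mono (c * chi n) (4 * n ^+ 2 + 2 + 6 * (al + be) * n + d) *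
         (theta5 (al - n - 2) * theta5 (be - n - 2))) =
  - Sum (fun u => mono (c * eps (n + usum u + al + be))
           (Uexp u + 15 * n * (n + 3) - 30 * n * usum u + d)).
Proof.
set e := _ + d => ce.
have cC : mono (c * chi n) e = mono (c * eps n) e * mono (chi n * eps n) 0.
  have [->|c0] := eqVneq c 0; first by rewrite !mul0r !mono0 mul0r.
  rewrite monoM ?ce // addr0; congr mono.
  by rewrite -mulrA [eps n * _]mulrC -mulrA eps_sqr mulr1.
rewrite cC; set T := _ * theta5 _.
have -> : Eul5 * (mono (c * eps n) e * mono (chi n * eps n) 0 * T) =
    - (mono (c * eps n) e * (- (mono (chi n * eps n) 0 * Eul5) * T)) by ring.
rewrite {}/T -Eul5_shift (mono_mul_Sum3 (smb_Eul5_shift n) (smb_theta5 _) (smb_theta5 _)) => [|c0|a|a|a].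
- congr (- _); apply: eq_Sum => -[a [x w]] /=; congr mono; last by rewrite /e /Uexp /usum /=; ring.
  rewrite -!mulrA -!epsD; congr (_ * _); apply: eq_eps; rewrite /usum /=; lia.
- by apply: ce; move: c0; rewrite mulf_eq0 negb_or => /andP[].
- by have := consec_ge0 (3 * a - n - 1); lia.
- by have := consec_ge0 (5 * a + (al - n - 2)); lia.
- by have := consec_ge0 (5 * a + (be - n - 2)); lia.
Qed.

(** Once the part in [n] alone is removed, the exponent is a positive combination of three products
    of consecutive integers, each dominating one of the indices. *)
Lemma Uexp_bound (n : int) u :
  (nrm u)%:Z <= Uexp u + 15 * n * (n + 3) - 30 * n * usum u
     - (4 * n ^+ 2 + 2 + 6 * (al + be) * n) + 3 * (absz n)%:Z + (24 + absz al + absz be)%:Z.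
Proof.
case: u => a [x w]; rewrite /Uexp /usum /=.
have := absz_consec (3 * a - n - 1).
have := absz_consec (5 * x + (al - n - 2)).
have := absz_consec (5 * w + (be - n - 2)).
lia.
Qed.

(** The choice [al + be = -1] produces the exponent of [Eul]. After multiplication by [Eul5], the
    reflection [n -> 2 * usum u - 3 - n] preserves the exponent and reverses the sign. *)
Lemma theta5_orthogonal : al + be = -1 ->
  Sum (fun n : int => mono (chi n) (4 * n ^+ 2 + 2 - 6 * n) *
         (theta5 (al - n - 2) * theta5 (be - n - 2))) = 0.
Proof.
move=> albe; apply: (fps_mulf_eq0 _ Eul5_neq0); rewrite Sum_mull; last first.
  by apply: (@smb_monoM _ _ 1 10) => n _ /=; nia.
pose f (v : int * (int * (int * int))) :=
  mono (eps (v.1 + usum v.2 + al + be))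
    (Uexp v.2 + 15 * v.1 * (v.1 + 3) - 30 * v.1 * usum v.2).
have sf : smb f.
  apply: (@smb_mono _ _ _ 1 (126 + absz al + absz be)) => -[n u] _.
  have := Uexp_bound n u; have := abs_sqr n 10; rewrite albe /=; lia.
transitivity (- Sum f).
  rewrite (Sum_pair sf) -SumN; last exact: smb_pair.
  apply: eq_Sum => n; rewrite -[chi n]mul1r.
  have <- : 4 * n ^+ 2 + 2 + 6 * (al + be) * n + 0 = 4 * n ^+ 2 + 2 - 6 * n.
    by rewrite albe; ring.
  rewrite theta5_expand => [|_]; last by rewrite albe; nia.
  by congr (- _); apply: eq_Sum => u; rewrite mul1r addr0.
rewrite (@Sum_invol _ _ (fun v => (2 * usum v.2 - 3 - v.1, v.2)) f) ?oppr0 //.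
  by move=> [n u] /=; congr pair; ring.
move=> [n u]; rewrite /f -monoN /=; congr mono; last by ring.
by apply: epsNN; lia.
Qed.

End Expansion.

(* [sg n l] is the coefficient of [x ^ (n * l)] in [1 / (1 - x ^ n)] expanded at
   [x = 0]; for [n < 0] the expansion is [- x ^ (- n) - x ^ (- 2 * n) - ...]. *)
Definition sg (n l : int) : K := ((0 < n) && (0 <= l))%:R - ((n < 0) && (l < 0))%:R.

Lemma sg_neq0 n l : sg n l != 0 -> 0 < n /\ 0 <= l \/ n < 0 /\ l < 0.
Proof.
rewrite /sg; case: (ltrP 0 n) => n0; case: (lerP 0 l) => l0; rewrite ?andbF ?andbT /=.
- by left.
- by rewrite ltNge (ltW n0) subrr eqxx.
- by rewrite subrr eqxx.
- by case: ltP => n1; [right|rewrite subrr eqxx].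
Qed.

Lemma sg_mul n l : sg n l != 0 ->
  [/\ (absz l)%:Z <= n * l, 0 < n \/ (absz n)%:Z <= n * l & 0 < n /\ 0 <= l \/ n < 0 /\ l < 0].
Proof.
move/sg_neq0 => nl; split=> //; first by case: nl => -[]; nia.
by case: nl => -[n0 l0]; [left|right; nia].
Qed.

Definition strip (m l : int) : K := (0 <= l + m)%R%:R - (0 <= l)%R%:R.

(** The indicator of [l >= 0] and minus the indicator of [l < 0] differ by a constant, so both
    expansions of the geometric series change alike under a shift of [l]. *)
Lemma sg_shift n l m : sg n (l + m) = sg n l + (n != 0)%:R * strip m l.
Proof.
rewrite /sg /strip; case: (ltgtP n 0) => n0; rewrite ?n0 ?eqxx /= ?mul0r ?addr0 //.
  rewrite mul1r !sub0r !ltNge.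
  by do 2!case: (0 <= _); rewrite /= ?subrr ?subr0 ?sub0r ?oppr0 ?addr0 ?add0r ?addNr.
rewrite mul1r !subr0.
by do 2!case: (0 <= _); rewrite /= ?subrr ?subr0 ?sub0r ?addr0 ?add0r ?addrN.
Qed.

(** The strip consists of [|m|] integers, each counted with the sign of [m]. *)
Lemma Sum_strip (m e : int) (c : K) :
  Sum (fun l : int => mono (strip m l * c) e) = mono (m%:~R * c) e.
Proof.
have sumc (r : seq int) (x : K) : uniq r ->
    (forall l, strip m l = if l \in r then x else 0) ->
    Sum (fun l : int => mono (strip m l * c) e) = mono (x *+ size r * c) e.
  move=> ur sr; apply: fpsP => n; rewrite (@SumE _ _ _ r) // => [|l /negPf lr].
    rewrite (eq_big_seq (fun=> mono (x * c) e n)) => [|l lr]; last by rewrite sr lr.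
    rewrite big_const_seq count_predT iter_addr_0 /=; case: ifP => _.
      by rewrite mulrnAl.
    by rewrite mul0rn.
  by rewrite sr lr mul0r mono0.
have stripE l : strip m l = (if (0 <= l + m) && (l < 0) then 1 else 0)
   - (if (l + m < 0) && (0 <= l) then 1 else 0).
  rewrite /strip !ltNge; do 2!case: (0 <= _);
  by rewrite /= ?subrr ?subr0 ?sub0r.
case: m sumc stripE => m sumc stripE.
  rewrite (sumc (map Negz (iota 0 m)) 1) ?size_map ?size_iota // => [|l].
    by rewrite map_inj_uniq ?iota_uniq // => x y [].
  rewrite stripE [X in _ - X]ifF ?subr0; last by apply/negbTE; lia.
  congr (if _ then _ else _); apply/idP/mapP => [lm|[x]].
    by exists (absz l).-1; rewrite ?mem_iota; lia.
  by rewrite mem_iota => xm ->; lia.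
rewrite (sumc (map Posz (iota 0 m.+1)) (-1)) ?size_map ?size_iota // => [||l].
- by rewrite NegzE mulNrn mulrNz pmulrn.
- by rewrite map_inj_uniq ?iota_uniq // => x y [].
rewrite stripE [X in X - _]ifF ?sub0r; last by apply/negbTE; lia.
suff -> : (l + Negz m < 0) && (0 <= l) = (l \in map Posz (iota 0 m.+1)).
  by case: ifP; rewrite ?oppr0.
apply/idP/mapP => [lm|[x]].
  by exists (absz l); rewrite ?mem_iota; lia.
by rewrite mem_iota => xm ->; lia.
Qed.

(** * A partial fraction identity *)

Section PF.
Variable b : int.
Hypothesis b_bound : 0 <= b <= 4.
Local Notation idx := ((int * int) * (int * (int * int)))%type.

Let co (v : int * int) (u : int * (int * int)) := eps (v.1 + usum u + b).
Let ex (v : int * int) (u : int * (int * int)) :=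
  Uexp 0 b u + 15 * v.1 * (v.1 + 3) + 30 * v.1 * v.2.

(** On the support of [sg], [n * l] is nonnegative, and at least [- n] when [n < 0]. As [b <= 4],
    the term [30 * n * l] then outweighs [6 * b * n], so exponents stay nonnegative. *)
Lemma sg_exp n l : sg n l != 0 ->
  4 * (absz n)%:Z + (absz l)%:Z <= 4 * n ^+ 2 + 6 * b * n + 30 * n * l.
Proof.
have [b0 b4] := andP b_bound; have n2 : (absz n)%:Z <= n ^+ 2 by nia.
case/sg_mul => l1 [] n1 [] [n0 l0].
- have : 0 <= b * n by nia.
  lia.
- have : 4 * n <= b * n by nia.
  lia.
- have : 0 <= b * n by nia.
  lia.
- have : 4 * n <= b * n by nia.
  lia.
Qed.

Lemma Uexp_ge u : (nrm u)%:Z <= Uexp 0 b u.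
Proof.
case: u => a [x w]; rewrite /Uexp /=.
have := absz_consec a; have := absz_consec x.
have : (absz w)%:Z <= 75 * (w * (w - 1)) + 30 * b * w + 3 * b ^+ 2 - 15 * b + 18.
  have w1 := absz_consec w; have w2 := consec_ge0 w.
  have neg : w < 0 -> - 2 * w <= w * (w - 1) by nia.
  have [b0 b4] := andP b_bound.
  have bE : b = 0 \/ b = 1 \/ b = 2 \/ b = 3 \/ b = 4 by lia.
  by case: (lerP 0 w) => [w0|/neg]; case: bE => [|[|[|[|]]]] ->; lia.
lia.
Qed.

(* The shift [l -> l + usum u] turns the sum [g] into [f = f1 + f2 - f3]. Each of
   [f1] and [f2] is killed by a sign-reversing involution, [a -> 1 - a] and
   [n -> - 3 - 2 * l - n]; summed over [l], the terms [n = 0] collected in [f3]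
   become linear in [u] and are killed by [a -> 1 - a] or [x -> 1 - x]. *)
Let f (p : idx) := mono (sg p.1.1 (p.1.2 + usum p.2) * co p.1 p.2) (ex p.1 p.2).
Let f1 (p : idx) := mono (sg p.1.1 p.1.2 * co p.1 p.2) (ex p.1 p.2).
Let f2 (p : idx) := mono (strip (usum p.2) p.1.2 * co p.1 p.2) (ex p.1 p.2).
Let f3 (p : idx) :=
  mono ((p.1.1 == 0)%:R * (strip (usum p.2) p.1.2 * co p.1 p.2)) (ex p.1 p.2).

Let fE p : f p = f1 p + f2 p - f3 p.
Proof.
rewrite /f /f1 /f2 /f3 -!monoN -!monoD sg_shift; congr mono.
by case: eqP => _ /=; ring.
Qed.

Let g (p : idx) := mono (sg p.1.1 p.1.2 * co p.1 p.2)
  (Uexp 0 b p.2 + 15 * p.1.1 * (p.1.1 + 3) - 30 * p.1.1 * usum p.2 + 30 * p.1.1 * p.1.2).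

Let smb_g : smb g.
Proof.
apply: (@smb_mono _ _ _ 1 30) => -[[n l] u]; rewrite /g mulf_eq0 negb_or /= => /andP[/sg_exp nl _].
have := Uexp_bound 0 b n u; move: nl b_bound; rewrite /=; lia.
Qed.

Let shift (p : idx) : idx := ((p.1.1, p.1.2 + usum p.2), p.2).

Let f_shift p : f p = g (shift p).
Proof. by rewrite /f /g /co /ex /=; congr mono; ring. Qed.

Let shift_inj : injective shift.
Proof. by move=> [[n l] u] [[n' l'] u'] [-> + uu]; rewrite uu => /addIr ->. Qed.

Let smb_f : smb f.
Proof.
have -> : f = fun p => g (shift p) by apply/funext => p; apply: f_shift.
exact: smb_reindex.
Qed.

Let Sum_f : Sum g = Sum f.
Proof.
rewrite (Sum_reindex shift_inj); first by apply: eq_Sum => p; rewrite f_shift.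
move=> [[n l] u] _; exists ((n, l - usum u), u).
by rewrite /shift /= subrK.
Qed.

Let smb_f1 : smb f1.
Proof.
apply: (@smb_mono _ _ _ 1 100) => -[[n l] u]; rewrite mulf_eq0 negb_or /= => /andP[/sg_mul nl _].
have := Uexp_ge u; rewrite /ex /=.
suff : (absz n)%:Z + (absz l)%:Z <= 15 * n * (n + 3) + 30 * n * l + 100 by lia.
have := abs_sqr n 2; rewrite expr2 => n2; case: nl => l1 [] n1 [] [n0 l0]; lia.
Qed.

Let smb_f3 : smb f3.
Proof.
apply: (@smb_mono _ _ _ 2 10) => -[[n l] [a [x w]]] /=; rewrite mulf_eq0 negb_or => /andP[].
have [->|] := eqVneq n 0; last by rewrite eqxx.
move=> _; rewrite mulf_eq0 negb_or => /andP[sl _].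
have := Uexp_ge (a, (x, w)); rewrite /ex /=.
suff : (absz l)%:Z <= (absz a)%:Z + (absz x)%:Z + (absz w)%:Z by lia.
move: sl; rewrite /strip /usum /=.
by case: (lerP 0 l) => l0; case: lerP => l1; rewrite ?subrr ?eqxx //; lia.
Qed.

Let smb_f2 : smb f2.
Proof.
(* Summability is inherited from the three other families. *)
have -> : f2 = fun p => f p - f1 p + f3 p.
  by apply/funext => p; rewrite fE; ring.
by apply: smbD => //; apply: smbB.
Qed.

Let Sum_f1 : Sum f1 = 0.
Proof.
apply: (@Sum_invol _ _ (fun p => (p.1, (1 - p.2.1, p.2.2)))) => // [[v [a u]]|[v [a u]]] /=.
  by rewrite subKr.
rewrite /f1 -monoN /=; congr mono; last by rewrite /ex /Uexp /=; ring.
by rewrite /co -[RHS]mulrN; congr (_ * _); apply: epsNN; rewrite /usum /=; lia.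
Qed.

Let Sum_f2 : Sum f2 = 0.
Proof.
apply: (@Sum_invol _ _ (fun p => ((- 3 - 2 * p.1.2 - p.1.1, p.1.2), p.2))) => //.
  by move=> [[n l] u] /=; congr pair; congr pair; ring.
move=> [[n l] u]; rewrite /f2 -monoN /=; congr mono; last by rewrite /ex /=; ring.
by rewrite /co -[RHS]mulrN; congr (_ * _); apply: epsNN; rewrite /=; lia.
Qed.

Let Sum_lin (h : int * (int * int) -> int) (s : int * (int * int) -> int * (int * int)) :
  involutive s -> (forall u, h (s u) = h u) -> (forall u, Uexp 0 b (s u) = Uexp 0 b u) ->
  (forall u, (usum (s u) %% 2)%Z = ((usum u + 1) %% 2)%Z) ->
  Sum (fun u => mono ((h u)%:~R * eps (usum u + b)) (Uexp 0 b u)) = 0.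
Proof.
move=> sK hs Us us; apply: (Sum_invol sK) => [|u].
  by apply: (@smb_mono _ _ _ 1 0) => u _; have := Uexp_ge u; lia.
rewrite hs Us -monoN; congr mono; rewrite -[RHS]mulrN; congr (_ * _).
by apply: epsNN; have := us u; lia.
Qed.

Let Sum_f3 : Sum f3 = 0.
Proof.
pose h (q : (int * (int * int)) * int) : idx := ((0, q.2), q.1).
have hinj : injective h by move=> [u l] [u' l'] [-> ->].
rewrite (Sum_reindex hinj) => [|[[n l] u]]; last first.
  have [->|n0] := eqVneq n 0; first by exists (u, l).
  by rewrite /f3 /= (negPf n0) mul0r mono0 eqxx.
rewrite Sum_pair; last exact: smb_reindex.
transitivity (Sum (fun u => mono ((usum u)%:~R * eps (usum u + b)) (Uexp 0 b u))).
  apply: eq_Sum => u; rewrite -Sum_strip; apply: eq_Sum => l.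
  by rewrite /f3 /h /co /ex /= mul1r add0r mulr0 mul0r mulr0 mul0r !addr0.
have sm (k : int * (int * int) -> int) :
    smb (fun u => mono ((k u)%:~R * eps (usum u + b)) (Uexp 0 b u)).
  by apply: (@smb_mono _ _ _ 1 0) => u _; have := Uexp_ge u; lia.
transitivity (Sum (fun u => mono ((u.1 + u.2.1)%:~R * eps (usum u + b)) (Uexp 0 b u)
    + mono ((u.2.2)%:~R * eps (usum u + b)) (Uexp 0 b u))).
  by apply: eq_Sum => u; rewrite -monoD -mulrDl -rmorphD.
rewrite SumD //; transitivity (Sum (fun u => mono ((u.1)%:~R * eps (usum u + b)) (Uexp 0 b u)
    + mono ((u.2.1)%:~R * eps (usum u + b)) (Uexp 0 b u))
    + Sum (fun u => mono ((u.2.2)%:~R * eps (usum u + b)) (Uexp 0 b u))).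
  by congr (_ + _); apply: eq_Sum => u; rewrite -monoD -mulrDl -rmorphD.
rewrite SumD //.
pose s1 (u : int * (int * int)) := (1 - u.1, u.2).
pose s2 (u : int * (int * int)) := (u.1, (1 - u.2.1, u.2.2)).
have s1K : involutive s1 by case=> a u; rewrite /s1 /= subKr.
have s2K : involutive s2 by case=> a [x w]; rewrite /s2 /= subKr.
(* Each linear coefficient is left fixed by a reflection in another variable. *)
rewrite (Sum_lin (h := fun u => u.1) s2K) ?(Sum_lin (h := fun u => u.2.1) s1K)
        ?(Sum_lin (h := fun u => u.2.2) s1K) ?addr0 //;
  by case=> a [x w]; rewrite /Uexp /usum /=; (ring || lia).
Qed.

(** Summing over [l] turns [sg] into the expansion of [1 / (1 - t^(30 n))], so this is a relation
    between Lambert-type series. It is again proved after multiplication by [Eul5]. *)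
Lemma partial_fractions :
  Sum (fun v : int * int => mono (sg v.1 v.2 * chi v.1)
         (4 * v.1 ^+ 2 + 2 + 6 * b * v.1 + 30 * v.1 * v.2) *
         (theta5 (- v.1 - 2) * theta5 (b - v.1 - 2))) = 0.
Proof.
apply: (fps_mulf_eq0 _ Eul5_neq0); rewrite Sum_mull; last first.
  apply: (@smb_monoM _ _ 1 0) => -[n l] /=; rewrite mulf_eq0 negb_or => /andP[/sg_exp nl _].
  lia.
transitivity (- Sum g).
  rewrite (Sum_pair smb_g) -SumN; last exact: smb_pair.
  apply: eq_Sum => -[n l] /=.
  have -> : theta5 (- n - 2) = theta5 (0 - n - 2) by rewrite sub0r.
  have -> : 4 * n ^+ 2 + 2 + 6 * b * n + 30 * n * l =
            4 * n ^+ 2 + 2 + 6 * (0 + b) * n + 30 * n * l by rewrite add0r.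
  rewrite theta5_expand => [|/sg_exp]; last by move: b_bound; lia.
  by congr (- _); apply: eq_Sum => u; rewrite /g /co /= addr0.
rewrite Sum_f (eq_Sum (f := f) (g := fun p => f1 p + f2 p - f3 p)) //.
by rewrite SumB ?SumD ?Sum_f1 ?Sum_f2 ?Sum_f3 ?subr0 ?addr0 ?oppr0 //; apply: smbD.
Qed.

End PF.

End PartialFractions.

(** * Hecke-type double sums *)

Section HeckeSeries.
Local Open Scope ring_scope.
Variable K : numFieldType.
Local Notation fps := (fps K).
Local Notation eps := (eps K).
Local Notation chi := (chi K).
Local Notation mono := (@mono K).

Lemma Sum_int (f : int -> fps) : smb f ->
  Sum f = Sum (fun n : nat => f n.+1%:Z) + Sum (fun n : nat => f (- n%:Z)).
Proof.
move=> sf; rewrite (@Sum_partition _ _ 2 (fun i => (i <= 0)%R) f) // => [|i]; last by case: (i <= 0).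
rewrite !big_ord_recl big_ord0 addr0 /=; congr (_ + _).
  rewrite (@Sum_reindex _ _ _ (fun n : nat => n.+1%:Z)) => [|x y []//|i]; last first.
    by case: ifP => [i0 _|_ /eqP//]; exists (absz i).-1; lia.
  by apply: eq_Sum => n.
rewrite (@Sum_reindex _ _ _ (fun n : nat => - n%:Z)) => [|x y|i].
- by apply: eq_Sum => n; rewrite oppr_le0.
- by move=> /oppr_inj [].
- case: ifP => [|_ /eqP//]; case: (lerP i 0) => // i0 _ _; exists (absz i); lia.
Qed.

Lemma Sum_mono_nat0 (f : nat -> fps) : smb f -> f 0%N = 0 ->
  Sum f = Sum (fun n : nat => f n.+1).
Proof. by move=> sf f0; rewrite Sum_natS // f0 add0r. Qed.

(* The product (q)_oo, in the form that comes out of [hecke_row_even]; see [Eul_qp]. *)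
Definition Eul : fps := Sum (fun n : int => mono (chi n) (4 * n ^+ 2 + 2 - 6 * n)).

Lemma smb_Eul : smb (fun n : int => mono (chi n) (4 * n ^+ 2 + 2 - 6 * n)).
Proof. by apply: (@smb_mono _ _ _ 1 10) => n _ /=; nia. Qed.

Definition hecke_exp (j r : int) : int := 3 * (j * (j + 1) + r * (r - 1) + 4 * r * j).

Definition hecke (j : nat) : fps :=
  Sum (fun r : nat => mono (eps (j%:Z + r%:Z)) (hecke_exp j%:Z r%:Z)).

Lemma smb_hecke (j : nat) :
  smb (fun r : nat => mono (eps (j%:Z + r%:Z)) (hecke_exp j%:Z r%:Z)).
Proof. by apply: (@smb_mono _ _ _ 1 10) => r _; rewrite /hecke_exp /=; nia. Qed.

(** Summed over [p], this is the coefficient of [z^i] in G theta: [p.2] is the index in theta, and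
    [i - p.2] is the power of [z] taken from G. *)
Definition Gth_term (i : int) (p : nat * int) : fps :=
  mono (chi p.1%:Z * eps p.2)
    (4 * p.1%:Z ^+ 2 + 2 + 6 * p.1%:Z * (absz (i - p.2))%:Z + 3 * (p.2 * (p.2 - 1))).

Lemma smb_Gth i : smb (Gth_term i).
Proof.
apply: (@smb_mono _ _ _ 1 10) => -[n k] _ /=.
have : 0 <= n%:Z * (absz (i - k))%:Z by apply: mulr_ge0.
have := absz_consec k; have := abs_sqr n 1; lia.
Qed.

Section FixedIndex.
Variable j : nat.
Hypothesis j_gt0 : (0 < j)%N.

(** The contribution of the theta index [j + a + 1]; the negative [n] come from the correction term
    in [Gth_hecke]. *)
Let T (a : nat) := Sum (fun n : int => mono (chi n * eps (j%:Z + a%:Z + 1))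
  (4 * n ^+ 2 + 2 + 6 * n * (a%:Z + 1) + 3 * ((j%:Z + a%:Z + 1) * (j%:Z + a%:Z)))).

(** The reflection [n -> - 3 * (r + 1) - n] fixes the exponent and negates [n] modulo 3, where [chi]
    is odd. *)
Lemma hecke_row_odd (r : nat) : T r.*2.+1 = 0.
Proof.
apply: (@Sum_invol _ _ (fun n : int => - 3 * (r%:Z + 1) - n)) => [n||n]; first by ring.
  apply: (@smb_mono _ _ _ 1 (100 + 50 * r * r)) => n _ /=; nia.
rewrite -monoN; congr mono; last by rewrite -muln2; ring.
by rewrite -mulNr; congr (_ * _); apply: chiNN; lia.
Qed.

(** A translation of [n] by a multiple of 3, combined with [n -> - n] when [r] is even, turns the
    exponent into that of [Eul] plus a constant; [chi] changes at most by a sign. *)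
Lemma hecke_row_even (r : nat) :
  T r.*2 = mono (eps (j%:Z + r%:Z)) (hecke_exp j%:Z r%:Z) * Eul.
Proof.
rewrite mulrC Sum_mulr; last exact: smb_Eul.
have he n : mono (chi n) (4 * n ^+ 2 + 2 - 6 * n) * mono (eps (j%:Z + r%:Z)) (hecke_exp j r) =
    mono (chi n * eps (j%:Z + r%:Z)) (4 * n ^+ 2 + 2 - 6 * n + hecke_exp j r).
  by rewrite monoM //; rewrite ?/hecke_exp; nia.
have [s [rs|rs]] : exists s : nat, r = s.*2 \/ r = s.*2.+1 by exists r./2; lia.
  rewrite /T (@Sum_reindex _ _ _ (fun n : int => - n - 3 * s%:Z)) => [|x y|n _].
  - apply: eq_Sum => n; rewrite he; congr mono; last by rewrite /hecke_exp rs -!muln2 !PoszM; ring.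
    have rE : r%:Z = 2 * s%:Z by lia.
    rewrite -[RHS]mulrNN -muln2 PoszM rE; congr (_ * _); first by apply: chiNN; lia.
    by apply: epsNN; lia.
  - by move=> /addIr /oppr_inj.
  - by exists (- n - 3 * s%:Z); ring.
rewrite /T (@Sum_reindex _ _ _ (fun n : int => n - 3 * (s%:Z + 1))) => [|x y|n _].
- apply: eq_Sum => n; rewrite he; congr mono; last first.
    have rE : r%:Z = 2 * s%:Z + 1 by lia.
    by rewrite /hecke_exp -muln2 PoszM rE; ring.
  have -> : r%:Z = 2 * s%:Z + 1 by lia.
  congr (_ * _); first by apply: eq_chi; lia.
  by apply: eq_eps; lia.
- by move=> /addIr.
- by exists (n + 3 * (s%:Z + 1)); ring.
Qed.

(** Without the absolute value in the exponent the sum [Q] vanishes, by [k -> 1 + 2 * n - k]. Only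
    the indices [k > j] feel the absolute value; there, [chi] being odd, the two versions combine
    into the sums [T a] over all integers [n]. *)
Lemma Gth_hecke : Sum (Gth_term j%:Z) = Eul * hecke j.
Proof.
pose Q (p : nat * int) := mono (chi p.1%:Z * eps p.2)
  (4 * p.1%:Z ^+ 2 + 2 + 6 * p.1%:Z * (j%:Z - p.2) + 3 * (p.2 * (p.2 - 1))).
have Qexp (n : nat) (k : int) : 4 * n%:Z ^+ 2 + 2 + 6 * n%:Z * (j%:Z - k) + 3 * (k * (k - 1)) =
    3 * ((k - n%:Z) * (k - n%:Z - 1)) + n%:Z ^+ 2 + 6 * n%:Z * (j%:Z - 1) + 3 * n%:Z + 2 by ring.
have sQ : smb Q.
  apply: (@smb_mono _ _ _ 1 10) => -[n k] _ /=; rewrite Qexp.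
  have : 0 <= n%:Z * (j%:Z - 1) by apply: mulr_ge0 => //; lia.
  have := absz_consec (k - n%:Z); have := abs_sqr n 1; lia.
have Q0 : Sum Q = 0.
  apply: (@Sum_invol _ _ (fun p => (p.1, 1 + 2 * p.1%:Z - p.2))) => // [[n k]|[n k]] /=.
    by congr pair; ring.
  rewrite /Q -monoN /= -mulrN; congr mono; last by ring.
  by congr (_ * _); apply: epsNN; lia.
pose R (p : nat * int) := if j%:Z < p.2 then Gth_term j p - Q p else 0.
have sR : smb R.
  by apply: (smb_sub (smbB (smb_Gth j) sQ)) => p m; rewrite /R; case: ifP => // _; rewrite fps0E eqxx.
transitivity (Sum (fun p => R p + Q p)).
  apply: eq_Sum => -[n k]; rewrite /R /=; case: ltP => [_|kj]; first by rewrite subrK.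
  rewrite add0r /Gth_term /Q /=; congr mono; rewrite gez0_abs //; lia.
rewrite SumD // Q0 addr0.
pose h (p : nat * nat) := (p.2, j%:Z + p.1%:Z + 1).
rewrite (@Sum_reindex _ _ _ h) => [|[a n] [a' n'] [-> e]|[n k]]; last 2 first.
- by congr pair; lia.
- rewrite /R /=; case: ltP => [kj _|_ /eqP //]; exists (absz (k - j%:Z - 1)%R, n).
  by rewrite /h /=; congr pair; lia.
pose S (p : nat * int) := mono (chi p.2 * eps (j%:Z + p.1%:Z + 1))
  (4 * p.2 ^+ 2 + 2 + 6 * p.2 * (p.1%:Z + 1) + 3 * ((j%:Z + p.1%:Z + 1) * (j%:Z + p.1%:Z))).
have sS : smb S.
  apply: (@smb_mono _ _ _ 1 100) => -[a n] _ /=.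
  have -> : 4 * n ^+ 2 + 2 + 6 * n * (a%:Z + 1) + 3 * ((j%:Z + a%:Z + 1) * (j%:Z + a%:Z)) =
    n ^+ 2 + 3 * (n + a%:Z + 1) ^+ 2 + 3 * (a%:Z + 1) + 2
    + 3 * ((j%:Z - 1) * (j%:Z + 2 * a%:Z + 2)) by ring.
  have : 0 <= (j%:Z - 1) * (j%:Z + 2 * a%:Z + 2) by apply: mulr_ge0; lia.
  have := abs_sqr n 1; have := sqr_ge0 (n + a%:Z + 1); lia.
have sT a : smb (fun n => S (a, n)) by exact: smb_row.
transitivity (Sum T).
  rewrite Sum_pair; last by apply: smb_reindex => // -[a n] [a' n'] [-> e]; congr pair; lia.
  apply: eq_Sum => a; rewrite /T (Sum_int (sT a)).
  have sp : smb (fun n : nat => S (a, n%:Z)) by apply: (smb_reindex _ (sT a)) => x y [].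
  have sn : smb (fun n : nat => S (a, - n%:Z)).
    by apply: (smb_reindex _ (sT a)) => x y /oppr_inj [].
  rewrite -(Sum_mono_nat0 sp) -?SumD //; last by rewrite /S /chi /= mul0r mono0.
  apply: eq_Sum => n; rewrite /R /h /=.
  have ja : j%:Z < j%:Z + a%:Z + 1 by lia.
  rewrite ja /Gth_term /Q /S /= -!monoN; congr (_ + _).
    congr mono.
    have -> : (absz (j%:Z - (j%:Z + a%:Z + 1))%R)%:Z = a%:Z + 1 by lia.
    by ring.
  congr mono; last by ring.
  by rewrite -mulNr; congr (_ * _); apply/esym/chiNN; lia.
rewrite Sum_mull; last exact: smb_hecke.
rewrite (@Sum_reindex _ _ _ double) => [|x y /double_inj //|a]; last first.
  have [r [->|->]] : exists r : nat, a = r.*2 \/ a = r.*2.+1 by exists a./2; lia.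
    by exists r.
  by rewrite hecke_row_odd eqxx.
by apply: eq_Sum => r; rewrite hecke_row_even mulrC.
Qed.

End FixedIndex.

(** This antisymmetry folds the sum over [z^i] onto positive indices, whence the coefficients
    [z^(j+1) - z^(-j)] of [Dser]. *)
Lemma Gth_sym i : Sum (Gth_term (1 - i)) = - Sum (Gth_term i).
Proof.
rewrite -SumN; last exact: smb_Gth.
rewrite (@Sum_reindex _ _ _ (fun p : nat * int => (p.1, 1 - p.2))) => [|[n k] [n' k'] /=|[n k] _].
- apply: eq_Sum => -[n k]; rewrite /Gth_term -monoN /= -mulrN; congr mono.
    by congr (_ * _); apply: epsNN; lia.
  have -> : (absz (1 - i - (1 - k))%R)%:Z = absz (i - k)%R by lia.
  by ring.
- by case=> -> /addrI /oppr_inj ->.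
- by exists (n, 1 - k); rewrite /= subKr.
Qed.

(** The coefficient of [z^d], and of [z^(-d)], in G. *)
Definition gser (d : nat) : fps :=
  Sum (fun n : nat => mono (chi n%:Z) (4 * n%:Z ^+ 2 + 2 + 6 * n%:Z * d%:Z)).

Lemma smb_gser d : smb (fun n : nat => mono (chi n%:Z) (4 * n%:Z ^+ 2 + 2 + 6 * n%:Z * d%:Z)).
Proof.
apply: (@smb_mono _ _ _ 1 10) => n _ /=; have := abs_sqr n 1.
have : 0 <= n%:Z * d%:Z by apply: mulr_ge0.
lia.
Qed.

Lemma Gfam_exp (d : int) (n : nat) : chi n%:Z != 0 ->
  n%:Z + (absz d)%:Z <= 4 * n%:Z ^+ 2 + 2 + 6 * n%:Z * (absz d)%:Z.
Proof.
move/chi_neq0 => n0; have n1 : 1 <= n%:Z by case: n n0.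
have : (absz d)%:Z <= n%:Z * (absz d)%:Z by rewrite ler_peMl.
have := abs_sqr n 1; lia.
Qed.

Section Argument.
Variable z : K.
Hypothesis z_neq0 : z != 0.

Definition theta : fps := Sum (fun i : int => mono (z ^ i * eps i) (3 * (i * (i - 1)))).

Lemma smb_theta : smb (fun i : int => mono (z ^ i * eps i) (3 * (i * (i - 1)))).
Proof. by apply: (@smb_mono _ _ _ 1 3) => i _ /=; have := absz_consec i; lia. Qed.

Lemma Sum_fold (f : int -> fps) : smb (fun j => mono (z ^ j) 0 * f j) ->
  (forall j, f (1 - j) = - f j) ->
  Sum (fun j => mono (z ^ j) 0 * f j) =
  Sum (fun j : nat => mono (z ^ j.+1%:Z - z ^ (- j%:Z)) 0 * f j.+1%:Z).
Proof.
move=> sf fo; rewrite (Sum_int sf) -SumD; last 2 first.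
- by apply: (smb_reindex _ sf) => x y [].
- by apply: (smb_reindex _ sf) => x y /oppr_inj [].
apply: eq_Sum => j; rewrite monoD monoN mulrBl; congr (_ + _).
have -> : - j%:Z = 1 - j.+1%:Z by lia.
by rewrite fo mulrN.
Qed.

Definition Gfam (p : int * nat) : fps :=
  mono (z ^ p.1 * chi p.2%:Z) (4 * p.2%:Z ^+ 2 + 2 + 6 * p.2%:Z * (absz p.1)%:Z).

Lemma smb_Gfam : smb Gfam.
Proof.
apply: (@smb_mono _ _ _ 1 10) => -[d n] /=; rewrite mulf_eq0 negb_or => /andP[_ /(Gfam_exp d)].
lia.
Qed.

Definition Gser : fps := Sum Gfam.

Lemma GserE : Gser = Sum (fun d : int => mono (z ^ d) 0 * gser (absz d)).
Proof.
rewrite /Gser Sum_pair; last exact: smb_Gfam.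
apply: eq_Sum => d; rewrite Sum_mull; last exact: smb_gser.
by apply: eq_Sum => n; rewrite monoM ?add0r //; nia.
Qed.

Definition Dser : fps :=
  Sum (fun j : nat => mono (z ^ j.+1%:Z - z ^ (- j%:Z)) 0 * hecke j.+1).

Lemma smb_Dser : smb (fun j : nat =>
  mono (z ^ j.+1%:Z - z ^ (- j%:Z)) 0 * hecke j.+1).
Proof.
apply: (@smb_nrm _ _ _ 1 10) => j n /fpsM_neq0P[a [c [<- _]]].
rewrite /hecke; have [r ur rP] := SumE_seq c (@smb_hecke j.+1).
rewrite (SumE ur rP) => S0; have /hasP[m _ /mono_neq0P[_]] : has (fun m : nat =>
      mono (eps (j.+1%:Z + m%:Z)) (hecke_exp j.+1%:Z m%:Z) c != 0) r.
  apply: contraNT S0 => /hasPn c0; rewrite big_seq big1 // => m /c0 /negPn /eqP //.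
by rewrite /hecke_exp /=; nia.
Qed.

(** The terms of the product are collected by the total power [j] of [z]; each coefficient is then a
    sum of [Gth_term j]. *)
Lemma Gser_theta : Gser * theta = Eul * Dser.
Proof.
pose f (q : int * (nat * int)) := mono (z ^ q.1) 0 * Gth_term q.1 q.2.
pose h (q : int * (nat * int)) := ((q.1 - q.2.2, q.2.1), q.2.2).
pose g (p : (int * nat) * int) := Gfam p.1 *
  mono (z ^ p.2 * eps p.2) (3 * (p.2 * (p.2 - 1))).
have sg : smb g by exact: (smb_prod smb_Gfam smb_theta).
have fh q : f q = g (h q).
  case: q => j [n i]; rewrite /f /g /Gfam /Gth_term /=.
  have i0 : 0 <= 3 * (i * (i - 1)) by have := consec_ge0 i; lia.
  have n0 (x : nat) : 0 <= 4 * n%:Z ^+ 2 + 2 + 6 * n%:Z * x%:Z by nia.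
  rewrite !monoM ?addr_ge0 //; congr mono; last by ring.
  by rewrite mulrACA -expfzDr // subrK.
have hinj : injective h by move=> [j [n i]] [j' [n' i']] [+ -> ii]; rewrite ii => /addIr ->.
have sf : smb f.
  have -> : f = fun q => g (h q) by apply/funext.
  exact: smb_reindex.
rewrite /Gser /theta Sum_prod; [|exact: smb_Gfam|exact: smb_theta].
rewrite -/g (Sum_reindex hinj) => [|[[d n] i] _]; last first.
  by exists (d + i, (n, i)); rewrite /h /= addrK.
transitivity (Sum f); first by apply: eq_Sum => q; rewrite fh.
have fE j : Sum (fun p => f (j, p)) = mono (z ^ j) 0 * Sum (Gth_term j).
  by rewrite Sum_mull //; exact: smb_Gth.
rewrite (Sum_pair sf) (eq_Sum fE) Sum_fold; last 2 first.
- have := smb_pair sf.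
  by rewrite (_ : (fun i => _) = fun j => mono (z ^ j) 0 * Sum (Gth_term j)) //; apply/funext.
- exact: Gth_sym.
rewrite Sum_mull; last exact: smb_Dser.
by apply: eq_Sum => j; rewrite Gth_hecke // mulrCA.
Qed.

Lemma theta_fold : theta = Sum (fun j : nat =>
  mono ((z ^ j.+1%:Z - z ^ (- j%:Z)) * eps j.+1%:Z) (3 * (j.+1%:Z * j%:Z))).
Proof.
pose f j := mono (eps j) (3 * (j * (j - 1))).
have fE j : mono (z ^ j * eps j) (3 * (j * (j - 1))) = mono (z ^ j) 0 * f j.
  by rewrite monoM ?add0r //; have := consec_ge0 j; lia.
rewrite /theta (eq_Sum fE) Sum_fold => [||j].
- apply: eq_Sum => j; rewrite monoM ?add0r //.
  by congr mono; congr (3 * (_ * _)); lia.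
- apply: (smb_sub smb_theta) => j n; by rewrite fE.
- by rewrite /f -monoN; congr mono; [apply: epsNN; lia|ring].
Qed.

End Argument.
End HeckeSeries.

(** * Vanishing coefficients *)

Section Vanishing.
Local Open Scope ring_scope.
Variable K : numFieldType.
Local Notation fps := (fps K).
Local Notation chi := (chi K).
Local Notation mono := (@mono K).
Local Notation Eul := (Eul K).
Local Notation theta5 := (theta5 K).

Lemma component_Sum M e (I : choiceType) (f : I -> fps) : smb f ->
  component M e (Sum f) = Sum (fun i => component M e (f i)).
Proof.
move=> sf; apply: fpsP => n; have [r ur fr] := SumE_seq n sf.
rewrite componentE (SumE ur) // (SumE ur) => [|i /fr fi]; last by rewrite componentE fi; case: ifP.
under [RHS]eq_bigr do rewrite componentE.
by case: ifP => // _; rewrite big1.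
Qed.

Lemma expz_mod (z : K) (M : nat) (m n : int) : z != 0 -> z ^+ M = 1 ->
  (m %% M%:Z)%Z = (n %% M%:Z)%Z -> z ^ m = z ^ n.
Proof.
move=> z0 zM mn; rewrite (divz_eq m M) (divz_eq n M) mn !expfzDr //.
by rewrite ![_ * M%:Z]mulrC -!exprz_exp -exprnP zM !exp1rz.
Qed.

Lemma Eul_coef0 : Eul 0%N != 0.
Proof.
rewrite (@SumE _ _ _ [:: 1%Z]) // => [|n].
  by rewrite big_seq1 /= oner_eq0.
rewrite inE => n1; apply/eqP; apply: contraNT n1 => /mono_neq0P[/chi_neq0 n3 /=]; nia.
Qed.

Lemma Eul_neq0 : Eul != 0.
Proof. exact: fps_unit_neq0 Eul_coef0. Qed.

Lemma theta_coef0 (z : K) : z != 0 -> theta z 0%N = 1 - z.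
Proof.
move=> z0; rewrite theta_fold //.
rewrite (@SumE _ _ _ [:: 0%N]) // => [|j].
  by rewrite big_seq1 /= expr1z expr0z mulrN1 opprB.
by rewrite inE => j0; apply/eqP; apply: contraNT j0 => /mono_neq0P[_ /=]; nia.
Qed.

(** * Residue classes of exponents in F theta = D *)

Section Dissection.
Variables (z : K) (M e : nat) (F : fps).
Hypotheses (z_neq0 : z != 0) (EF : Eul * F = Gser z).

Lemma F_theta : F * theta z = Dser z.
Proof.
apply/eqP; rewrite -subr_eq0; apply/eqP.
apply: (fps_mulf_eq0 _ Eul_neq0).
by rewrite mulrBr mulrA EF (Gser_theta z_neq0) subrr.
Qed.

(** The factor [z^j - z^(1-j)] in front of [hecke j] removes the index [j] as soon as the two powers
    agree. *)
Lemma component_Dser :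
  (forall j r : nat, (0 < j)%N -> (hecke_exp j%:Z r%:Z %% M%:Z)%Z = (e%:Z %% M%:Z)%Z ->
     z ^ j%:Z = z ^ (1 - j%:Z)) ->
  component M e (Dser z) = 0.
Proof.
move=> zj; rewrite /Dser component_Sum; last exact: smb_Dser.
apply: Sum_eq0 => j; rewrite /hecke Sum_mull; last exact: smb_hecke.
rewrite component_Sum; last by apply: smb_mull; apply: smb_hecke.
apply: Sum_eq0 => r; apply: fpsP => n; rewrite componentE fps0E.
case: eqP => // ne; apply/eqP; apply: contraT => /fpsM_neq0P[a [b [ab]]].
move=> /mono_neq0P[c0 a0] /mono_neq0P[_ be].
case/negP: c0; rewrite subr_eq0 (zj j.+1 r) //.
  by apply/eqP; congr (z ^ _); lia.
by rewrite -be !modz_nat -ne -ab; congr ((_ %% _)%N)%:Z; lia.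
Qed.

End Dissection.

(** Multiplication by [theta z] preserves the classes modulo 18, hence annihilates the class 12 of
    [F], which contains [6 * (3 * N + 2)]. *)
Lemma vanish_mod3 (z : K) (F : fps) (N : nat) : z != 0 -> z != 1 -> z ^+ 3 = 1 ->
  Eul * F = Gser z -> F (6 * (3 * N + 2))%N = 0.
Proof.
move=> z0 z1 z3 EF.
have th18 : graded 18 0 (theta z).
  rewrite theta_fold //; apply: graded_Sum => [|j].
    by apply: (@smb_mono _ _ _ 1 10) => j _ /=; nia.
  apply: graded_mono; rewrite mulf_eq0 negb_or => /andP[zj _].
  (* For [j] congruent to 1 modulo 3 the two powers of [z] cancel. Otherwise [j * (j + 1)] is
     divisible by 3 as well as by 2, so 18 divides the exponent. *)
  have j3 : (j %% 3 != 1)%N.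
    apply: contraNneq zj => j1; rewrite subr_eq0; apply/eqP.
    by apply: (@expz_mod _ 3) => //; lia.
  have -> : 3 * (j.+1%:Z * j%:Z) =
      3 * ((6 * (j %/ 6)%N%:Z + (j %% 6)%N%:Z + 1) * (6 * (j %/ 6)%N%:Z + (j %% 6)%N%:Z)) by lia.
  have : (j %% 6 %% 3 != 1)%N by lia.
  move: (j %/ 6)%N (ltn_pmod j (isT : (0 < 6)%N)) => a.
  by case: (j %% 6)%N => [|[|[|[|[|[|]]]]]] // _ _; lia.
have : component 18 12 (F * theta z) = 0.
  rewrite (F_theta z0 EF); apply: component_Dser => // j r j0 ex.
  (* For [j] congruent to 0 or 1 modulo 3 no [r] reaches the class 12; for 2, the powers [z^j] and
     [z^(1-j)] agree. *)
  have j2 : (j %% 3 = 2)%N.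
    move: ex; rewrite /hecke_exp.
    have -> : j%:Z = 3 * (j %/ 3)%N%:Z + (j %% 3)%N%:Z by lia.
    have -> : r%:Z = 3 * (r %/ 3)%N%:Z + (r %% 3)%N%:Z by lia.
    move: (j %/ 3)%N (r %/ 3)%N (ltn_pmod j (isT : (0 < 3)%N)) (ltn_pmod r (isT : (0 < 3)%N)) => a b.
    by case: (j %% 3)%N => [|[|[|]]] // _; case: (r %% 3)%N => [|[|[|]]] // _ ex; exfalso; lia.
  by apply: (@expz_mod _ 3) => //; lia.
rewrite -[12%N]addn0 component_mulr // mulrC => /fps_mulf_eq0 F12.
have /F12/(congr1 (fun f : fps => f (6 * (3 * N + 2))%N)) : theta z != 0.
  by apply: fps_unit_neq0; rewrite theta_coef0 // subr_eq0 eq_sym.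
by rewrite componentE ifT //; lia.
Qed.

(** * Fifth roots of unity *)

Section ModFive.
Local Notation A := (theta5 0).
Local Notation B := (theta5 4).

Lemma theta5_1 : theta5 1 = - A.
Proof. by rewrite -(theta5_opp K 0) subr0. Qed.

Lemma theta5_2 : theta5 2 = - B.
Proof. by rewrite -(theta5_opp K 4) -(theta5_period K (1 - 4) 1). Qed.

(** Modulo 5 the residue 3 is fixed by [rho -> 1 - rho], under which [theta5] is odd. *)
Lemma theta5_3 : theta5 3 = 0.
Proof.
have : theta5 3 = - theta5 3 by rewrite -(theta5_opp K 3) -(theta5_period K (1 - 3) 1).
move/eqP; rewrite -subr_eq0 opprK => /eqP S0; apply: fpsP => n.
have /eqP := congr1 (fun g : fps => g n) S0; rewrite fpsDE fps0E -mulr2n.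
by rewrite mulrn_eq0 /= => /eqP.
Qed.

Lemma graded_theta5 (rho : nat) (e : nat) :
  ((3 * (rho%:Z * (rho%:Z - 1))) %% 5)%Z = (e%:Z %% 5)%Z -> graded 5 e (theta5 rho%:Z).
Proof.
move=> re; apply: graded_Sum; first exact: smb_theta5.
by move=> x; apply: graded_mono => _; rewrite -re; nia.
Qed.

Lemma A_coef0 : A 0%N = 1.
Proof.
rewrite (@SumE _ _ _ [:: 0%Z]) // => [|x].
  by rewrite big_seq1 /=.
rewrite inE => x0; apply/eqP; apply: contraNT x0 => /mono_neq0P[_ /=]; nia.
Qed.

Lemma A_neq0 : A != 0.
Proof. by apply: fps_unit_neq0; rewrite A_coef0 oner_eq0. Qed.

Lemma B_neq0 : B != 0.
Proof.
suff B6 : B 6%N != 0 by apply: contraNneq B6 => ->.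
rewrite (@SumE _ _ _ [:: (-1)%Z]) // => [|x].
  by rewrite big_seq1 /= eps_neq0.
rewrite inE => x0; apply/eqP; apply: contraNT x0 => /mono_neq0P[_ /=]; nia.
Qed.

Definition res5 (n : int) : nat := absz (n %% 5)%Z.

Lemma res5_lt n : (res5 n < 5)%N. Proof. rewrite /res5; lia. Qed.

Lemma res5_period n : exists k, n = (res5 n)%:Z + 5 * k.
Proof. by exists (n %/ 5)%Z; rewrite /res5; lia. Qed.

Lemma sum5 (V : nmodType) (f : nat -> V) :
  \sum_(c < 5) f c = f 0%N + f 1%N + f 2%N + f 3%N + f 4%N.
Proof. by rewrite !big_ord_recr big_ord0 /= add0r. Qed.

Lemma theta_split (z : K) : z != 0 -> z ^+ 5 = 1 ->
  theta z = mono (1 - z) 0 * A + mono (z ^+ 4 - z ^+ 2) 0 * B.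
Proof.
move=> z0 z5; rewrite /theta (@Sum_partition _ _ 5 res5) => [||i]; [|exact: smb_theta|exact: res5_lt].
rewrite (eq_bigr (fun c : 'I_5 => mono (z ^+ c) 0 * theta5 c)) => [|c _]; last first.
  rewrite /theta5 Sum_mull; last exact: smb_theta5.
  rewrite (@Sum_reindex _ _ _ (fun x : int => 5 * x + c%:Z)) => [|x y|i].
  - apply: eq_Sum => x; rewrite ifT; last by rewrite /res5; have := ltn_ord c; lia.
    rewrite monoM //; last by have := consec_ge0 (5 * x + c%:Z); lia.
    rewrite add0r; congr mono; congr (_ * _); rewrite exprnP.
    by apply: (@expz_mod _ 5) => //; lia.
  - by move=> /addIr /mulfI; apply.
  - case: ifP => [/eqP ic _|_ /eqP//]; exists (i %/ 5)%Z; rewrite -ic /res5; lia.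
rewrite (sum5 (fun c => mono (z ^+ c) 0 * theta5 c%:Z)) /= expr0 mono1 expr1 !(monoD, monoN) mono1.
rewrite theta5_1 theta5_2 theta5_3; ring.
Qed.

(** Sorting by [n] modulo 5 refines sorting by exponents: the residues 1 and 3 have exponents in the
    class 0, the residue 2 in the class 1, the residues 0 and 4 in the class 2. *)
Definition Eulc (c : nat) : fps :=
  Sum (fun n : int => if res5 n == c then mono (chi n) (4 * n ^+ 2 + 2 - 6 * n) else 0).

Lemma Eul_split : Eul = Eulc 0 + Eulc 1 + Eulc 2 + Eulc 3 + Eulc 4.
Proof.
rewrite /Eul (@Sum_partition _ _ 5 res5) => [||i]; [|exact: smb_Eul|exact: res5_lt].
by rewrite (sum5 (fun c => Eulc c)).
Qed.

Lemma smb_if (I : choiceType) (P : pred I) (f : I -> fps) : smb f ->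
  smb (fun i => if P i then f i else 0).
Proof. by move=> sf; apply: (smb_sub sf) => i n; case: ifP => // _; rewrite fps0E eqxx. Qed.

Lemma graded_Eulc (c e : nat) :
  ((4 * c%:Z ^+ 2 + 2 - 6 * c%:Z) %% 5)%Z = (e%:Z %% 5)%Z -> graded 5 e (Eulc c).
Proof.
move=> ce; apply: graded_Sum => [|n]; first by apply: smb_if; apply: smb_Eul.
case: eqP => [nc|_]; last exact: graded0.
apply: graded_mono => _; rewrite -ce -nc; have [k] := res5_period n.
by move: (res5 n) => c' ->; rewrite !expr2; lia.
Qed.

Lemma theta5_res (al n : int) : theta5 (al - n - 2) = theta5 (al - (res5 n)%:Z - 2).
Proof.
have [k nk] := res5_period n; rewrite -(theta5_period K _ k); congr theta5.
by move: (res5 n) nk => c ->; ring.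
Qed.

(** Both theta factors in [theta5_orthogonal] depend on [n] only modulo 5. *)
Lemma Eulc_rel (al be : int) : al + be = -1 ->
  \sum_(c < 5) Eulc c * (theta5 (al - c%:Z - 2) * theta5 (be - c%:Z - 2)) = 0.
Proof.
move=> albe; rewrite -[RHS](theta5_orthogonal K albe).
rewrite (@Sum_partition _ _ 5 res5) => [||i]; [| |exact: res5_lt]; last first.
  by apply: (@smb_monoM _ _ _ 1 10) => n _ /=; nia.
apply: eq_bigr => c _; rewrite /Eulc Sum_mulr; last by apply: smb_if; apply: smb_Eul.
apply: eq_Sum => n; case: eqP => [nc|_]; last by rewrite mul0r.
by rewrite (theta5_res al n) (theta5_res be n) nc.
Qed.

Local Notation sg := (sg K).

(** The terms of G with [m = 5 * l + b], which share the power [z^b] when [z^5 = 1]. *)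
Definition Gfam5 (b : nat) (v : int * int) : fps := mono (sg v.1 v.2 * chi v.1)
  (4 * v.1 ^+ 2 + 2 + 6 * b%:Z * v.1 + 30 * v.1 * v.2).

Lemma smb_Gfam5 (b : nat) : (b < 5)%N -> smb (Gfam5 b).
Proof.
move=> b5; apply: (@smb_mono _ _ _ 1 10) => -[n l] /=; rewrite mulf_eq0 negb_or => /andP[nl _].
have b04 : 0 <= b%:Z <= 4 by lia.
have := sg_exp b04 nl; lia.
Qed.

Definition Gbc (b c : nat) : fps :=
  Sum (fun v : int * int => if res5 v.1 == c then Gfam5 b v else 0).

Lemma Gbc_split (b : nat) : (b < 5)%N -> Sum (Gfam5 b) = \sum_(c < 5) Gbc b c.
Proof.
move=> b5; apply: (@Sum_partition _ _ 5 (fun v => res5 v.1)); first exact: smb_Gfam5.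
by move=> v; apply: res5_lt.
Qed.

Lemma graded_Gbc (b c e : nat) : (b < 5)%N ->
  ((4 * c * c + 2 + b * c) %% 5 = e %% 5)%N -> graded 5 e (Gbc b c).
Proof.
move=> b5 bce; apply: graded_Sum => [|[n l]]; first by apply: smb_if; apply: smb_Gfam5.
case: eqP => [/= nc|_]; last exact: graded0.
apply: graded_mono => _; rewrite /= modz_nat -bce -nc -modz_nat; have [k] := res5_period n.
move: (res5 n) => c' ->; rewrite !expr2 !PoszD !PoszM; lia.
Qed.

Lemma Gbc_rel (b : nat) : (b < 5)%N ->
  \sum_(c < 5) Gbc b c * (theta5 (- c%:Z - 2) * theta5 (b%:Z - c%:Z - 2)) = 0.
Proof.
move=> b5; have b04 : 0 <= b%:Z <= 4 by lia.
rewrite -[RHS](partial_fractions K b04).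
rewrite (@Sum_partition _ _ 5 (fun v => res5 v.1)) => [||v]; [| |exact: res5_lt]; last first.
  apply: (@smb_monoM _ _ _ 1 10) => -[n l] /=; rewrite mulf_eq0 negb_or => /andP[nl _].
  have := sg_exp b04 nl; lia.
apply: eq_bigr => c _; rewrite /Gbc Sum_mulr; last by apply: smb_if; apply: smb_Gfam5.
apply: eq_Sum => -[n l] /=; case: eqP => [nc|_]; last by rewrite mul0r.
by have := theta5_res 0 n; rewrite !sub0r => ->; rewrite (theta5_res b n) nc.
Qed.

Lemma Gser_split (z : K) : z != 0 -> z ^+ 5 = 1 ->
  Gser z = \sum_(b < 5) mono (z ^+ b) 0 * Sum (Gfam5 b).
Proof.
move=> z0 z5; pose f (v : int * int) := mono (sg v.1 v.2 * (chi v.1 * z ^ v.2))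
  (4 * v.1 ^+ 2 + 2 + 6 * v.1 * v.2).
have sf : smb f.
  apply: (@smb_mono _ _ _ 1 10) => -[n m] /=; rewrite mulf_eq0 negb_or => /andP[nm _].
  have := abs_sqr n 1; case/sg_mul: nm; lia.
(* For negative [m] the absolute value is removed by replacing [n] with [- n]; the sign lost in
   [chi] is the one supplied by [sg]. *)
pose h (p : int * nat) : int * int := (if p.1 < 0 then - p.2%:Z else p.2%:Z, p.1).
have hinj : injective h.
  by move=> [d n] [d' n'] [/= e dd]; move: e; rewrite dd; case: ifP => _ e; congr pair; lia.
transitivity (Sum f).
  rewrite (Sum_reindex hinj) => [|[n m]]; last first.
    rewrite /f /=; have [->|/sg_neq0 nm _] := eqVneq (sg n m) 0; first by rewrite mul0r mono0 eqxx.
    by exists (m, absz n); rewrite /h /=; congr pair; case: ltP; lia.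
  rewrite /Gser; apply: eq_Sum => -[d n]; rewrite /Gfam /f /h /=.
  have [->|n0] := eqVneq n 0%N.
    case: ifP => _; rewrite ?oppr0 /chi /= [z ^ d * 0]mulr0 [0 * z ^ d]mul0r.
      by rewrite [sg _ _ * 0]mulr0 !mono0.
    by rewrite [sg _ _ * 0]mulr0 !mono0.
  case: ltP => d0; congr mono.
  - have -> : sg (- n%:Z) d = -1.
      rewrite /sg; have -> : (0 < - n%:Z) = false by lia.
      have -> : (- n%:Z < 0) = true by lia.
      by rewrite d0 /= mulr0n mulr1n sub0r.
    by rewrite (@chiNN _ (- n%:Z) n) // mulN1r mulNr opprK mulrC.
  - have -> : (absz d)%:Z = - d by lia.
    by ring.
  - have -> : sg n%:Z d = 1.
      rewrite /sg d0; have -> : (0 < n%:Z) = true by lia.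
      have -> : (n%:Z < 0) = false by lia.
      by rewrite /= mulr0n mulr1n subr0.
    by rewrite mul1r mulrC.
  - have -> : (absz d)%:Z = d by lia.
    by ring.
rewrite (@Sum_partition _ _ 5 (fun v => res5 v.2)) => [||v] //; last exact: res5_lt.
apply: eq_bigr => b _; rewrite Sum_mull; last exact: smb_Gfam5.
rewrite (@Sum_reindex _ _ _ (fun v : int * int => (v.1, 5 * v.2 + b%:Z))) => [|[n l] [n' l']|[n m]].
- apply: eq_Sum => -[n l] /=; rewrite ifT; last by rewrite /res5; have := ltn_ord b; lia.
  rewrite /f /Gfam5 /=.
  have -> : sg n (5 * l + b%:Z) = sg n l.
    have b5 := ltn_ord b; rewrite /sg.
    have -> : (0 <= 5 * l + b%:Z) = (0 <= l) by lia.
    by have -> : (5 * l + b%:Z < 0) = (l < 0) by lia.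
  have [->|nl] := eqVneq (sg n l) 0; first by rewrite !mul0r !mono0 mulr0.
  rewrite monoM //; last first.
    have b04 : 0 <= b%:Z <= 4 by have := ltn_ord b; lia.
    have := sg_exp b04 nl; lia.
  congr mono; last by ring.
  rewrite mulrA [RHS]mulrC; congr (_ * _); rewrite exprnP.
  by apply: (@expz_mod _ 5) => //; lia.
- by case=> -> /addIr /mulfI ->.
- case: ifP => [/eqP mb _|_ /eqP//]; exists (n, (m %/ 5)%Z); congr pair => /=.
  by move: mb; rewrite /res5; lia.
Qed.

Lemma component_Gser (z : K) (e : nat) : z != 0 -> z ^+ 5 = 1 ->
  component 5 e (Gser z) = \sum_(b < 5) \sum_(c < 5)
    mono (z ^+ b) 0 * (if ((4 * c * c + 2 + b * c) %% 5 == e %% 5)%N then Gbc b c else 0).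
Proof.
move=> z0 z5; rewrite Gser_split // component_sum; apply: eq_bigr => b _.
rewrite Gbc_split // mulr_sumr component_sum; apply: eq_bigr => c _.
have g : graded 5 ((4 * c * c + 2 + b * c) %% 5) (mono (z ^+ b) 0 * Gbc b c).
  rewrite -[(_ %% 5)%N]add0n; apply: gradedM; first exact: graded_const.
  by apply: graded_Gbc => //; rewrite modn_mod.
case: ifP => [/eqP ec|/negbT ec]; first by rewrite component_graded //; apply: eq_graded g; rewrite modn_mod.
by rewrite mulr0 (component_graded0 g) // modn_mod.
Qed.

Lemma theta5_red (rho : int) (k : int) (r : nat) : rho = r%:Z + 5 * k -> theta5 rho = theta5 r%:Z.
Proof. by move=> ->; rewrite theta5_period. Qed.

Section Final.
Variables (z : K) (F : fps).
Hypotheses (z_neq0 : z != 0) (z5 : z ^+ 5 = 1) (EF : Eul * F = Gser z).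

Local Notation E0 := (Eulc 1 + Eulc 3).
Local Notation E1 := (Eulc 2).
Local Notation E2 := (Eulc 0 + Eulc 4).
Local Notation F_ e := (component 5 e F).
Local Notation G_ e := (component 5 e (Gser z)).

Let gA : graded 5 0 A. Proof. exact: (@graded_theta5 0). Qed.
Let gB : graded 5 1 B. Proof. exact: (@graded_theta5 4). Qed.
Let gE0 : graded 5 0 E0. Proof. by apply: gradedD; apply: graded_Eulc. Qed.
Let gE1 : graded 5 1 E1. Proof. exact: graded_Eulc. Qed.
Let gE2 : graded 5 2 E2. Proof. by apply: gradedD; apply: graded_Eulc. Qed.

Let E0_neq0 : E0 != 0.
Proof.
apply: fps_unit_neq0; apply: contraNneq Eul_coef0 => e0; rewrite Eul_split.
have -> : Eulc 0 + Eulc 1 + Eulc 2 + Eulc 3 + Eulc 4 = E0 + (E1 + E2) by ring.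
rewrite (fpsDE E0 (E1 + E2)) e0 add0r (fpsDE E1 E2).
have [->|/gE1 //] := eqVneq (E1 0%N) 0; have [->|/gE2 //] := eqVneq (E2 0%N) 0.
by rewrite addr0.
Qed.

(** With [Erel2], this says that [E1 / E0 = B / A] and [E2 / E0 = - (B / A)^2]. It is the
    5-dissection of (q)_oo, where [B / A] is [- q R(q^5)] and R is the Rogers-Ramanujan continued
    fraction without its fractional power of q. *)
Let Erel1 : B * E0 = A * E1.
Proof.
have := @Eulc_rel 0 (-1) (erefl _).
rewrite (sum5 (fun c => Eulc c * (theta5 (0 - c%:Z - 2) * theta5 (-1 - c%:Z - 2)))).
(* Arguments are reduced to residues modulo 5; the products containing [theta5 3] then disappear. *)
rewrite ?(@theta5_red (0 - 0%:Z - 2) (-1) 3) // ?(@theta5_red (0 - 1%:Z - 2) (-1) 2) //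
  ?(@theta5_red (-1 - 1%:Z - 2) (-1) 1) // ?(@theta5_red (0 - 2%:Z - 2) (-1) 1) //
  ?(@theta5_red (-1 - 2%:Z - 2) (-1) 0) // ?(@theta5_red (0 - 3%:Z - 2) (-1) 0) //
  ?(@theta5_red (-1 - 3%:Z - 2) (-2) 4) // ?(@theta5_red (-1 - 4%:Z - 2) (-2) 3) //.
rewrite theta5_1 theta5_2 theta5_3 => e; apply/eqP; rewrite -subr_eq0; apply/eqP.
apply: (fps_mulf_eq0 _ A_neq0); rewrite -[RHS]e; ring.
Qed.

Let Erel2 : A * E2 = - (B * E1).
Proof.
have := @Eulc_rel 1 (-2) (erefl _).
rewrite (sum5 (fun c => Eulc c * (theta5 (1 - c%:Z - 2) * theta5 (-2 - c%:Z - 2)))).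
rewrite ?(@theta5_red (1 - 0%:Z - 2) (-1) 4) // ?(@theta5_red (-2 - 0%:Z - 2) (-1) 1) //
  ?(@theta5_red (1 - 1%:Z - 2) (-1) 3) // ?(@theta5_red (1 - 2%:Z - 2) (-1) 2) //
  ?(@theta5_red (-2 - 2%:Z - 2) (-2) 4) // ?(@theta5_red (-2 - 3%:Z - 2) (-2) 3) //
  ?(@theta5_red (1 - 4%:Z - 2) (-1) 0) // ?(@theta5_red (-2 - 4%:Z - 2) (-2) 2) //.
rewrite theta5_1 theta5_2 theta5_3 => e; apply/eqP; rewrite -subr_eq0 opprK; apply/eqP.
apply: (fps_mulf_eq0 _ B_neq0); rewrite -[RHS]oppr0 -[in RHS]e; ring.
Qed.

(** The class [a] of [F * (E0 + E1 + E2)], with [E1] and [E2] expressed through [E0]; the factor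
    [A ^+ 2] clears denominators. *)
Let Gcomp (a c d : nat) : (a = c + 1 %[mod 5])%N -> (a = d + 2 %[mod 5])%N ->
  A ^+ 2 * G_ a = E0 * (F_ a * A ^+ 2 + F_ c * A * B - F_ d * B ^+ 2).
Proof.
move=> ac ad.
have -> : Gser z = F * E0 + F * E1 + F * E2 by rewrite -EF Eul_split; ring.
rewrite !componentD.
have -> : component 5 a (F * E0) = F_ a * E0 by rewrite -[a in LHS]addn0 component_mulr.
have -> : component 5 a (F * E1) = F_ c * E1.
  by rewrite (eq_component _ ac) component_mulr.
have -> : component 5 a (F * E2) = F_ d * E2.
  by rewrite (eq_component _ ad) component_mulr.
have e1 : A ^+ 2 * E1 = A * B * E0 by rewrite expr2 -mulrA -Erel1; ring.
have e2 : A ^+ 2 * E2 = - (B ^+ 2 * E0).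
  by rewrite expr2 -mulrA Erel2 mulrN mulrCA -Erel1; ring.
transitivity (F_ a * E0 * A ^+ 2 + F_ c * (A ^+ 2 * E1) + F_ d * (A ^+ 2 * E2)); first by ring.
by rewrite e1 e2; ring.
Qed.

Let Gexpand (e : nat) : G_ e = \sum_(b < 5) \sum_(c < 5)
    mono (z ^+ b) 0 * (if ((4 * c * c + 2 + b * c) %% 5 == e %% 5)%N then Gbc b c else 0).
Proof. exact: component_Gser. Qed.

Let PF b := \sum_(c < 5) Gbc b c * (theta5 (- c%:Z - 2) * theta5 (b%:Z - c%:Z - 2)).

(** The five identities [PF b = 0], weighted by [z^b] and by monomials in [A] and [B], regroup into
    components of G. The common factor [A * B] is cancelled at the start. *)
Let lambert_relation :
  G_ 4 * A ^+ 4 + G_ 3 * A ^+ 3 * B + G_ 1 * A * B ^+ 3 - G_ 0 * B ^+ 4 = 0.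
Proof.
apply: (fps_mulf_eq0 _ A_neq0); apply: (fps_mulf_eq0 _ B_neq0).
pose Z b := mono (z ^+ b) 0.
have -> : B * (A * (G_ 4 * A ^+ 4 + G_ 3 * A ^+ 3 * B + G_ 1 * A * B ^+ 3 - G_ 0 * B ^+ 4)) =
    A ^+ 2 * B ^+ 2 * (Z 0%N * PF 0) - B ^+ 4 * (Z 1%N * PF 1 + Z 4%N * PF 4)
    - A ^+ 4 * (Z 2%N * PF 2 + Z 3%N * PF 3).
  rewrite !Gexpand /PF !big_ord_recr !big_ord0 /=.
  rewrite ?(@theta5_red (-6) (-2) 4) // ?(@theta5_red (-5) (-1) 0) // ?(@theta5_red (-4) (-1) 1) //
    ?(@theta5_red (-3) (-1) 2) // ?(@theta5_red (-2) (-1) 3) // ?(@theta5_red (-1) (-1) 4) //.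
  rewrite !(mulr0, add0r, addr0) -/(Z 0%N) -/(Z 1%N) -/(Z 2%N) -/(Z 3%N) -/(Z 4%N).
  rewrite theta5_1 theta5_2 theta5_3; ring.
have PF0 b : (b < 5)%N -> PF b = 0 by exact: Gbc_rel.
by rewrite !PF0 // !(mulr0, addr0, subr0).
Qed.

(** [D4] and [R] are two linear equations in [F_ 3] and [F_ 4]. As 6 is congruent to 1 modulo 5,
    exponents of t and of q have the same classes. *)
Lemma vanish_mod5 : 1 - z != 0 -> 2 - 2 * z + z ^+ 2 - z ^+ 4 != 0 ->
  F_ 3 = 0 /\ F_ 4 = 0.
Proof.
move=> z1 z2.
set al := mono (1 - z) 0; set be := mono (z ^+ 4 - z ^+ 2) 0.
have D4 : al * F_ 4 * A + be * F_ 3 * B = 0.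
  have : component 5 4 (F * theta z) = 0.
    rewrite (F_theta z_neq0 EF); apply: component_Dser => // j r j0 ex.
    (* Unless [j] is 3 modulo 5, no [r] reaches the class 4; for 3, the powers [z^j] and [z^(1-j)]
       agree. *)
    have j3 : (j %% 5 = 3)%N.
      move: ex; rewrite /hecke_exp.
      have -> : j%:Z = 5 * (j %/ 5)%N%:Z + (j %% 5)%N%:Z by lia.
      have -> : r%:Z = 5 * (r %/ 5)%N%:Z + (r %% 5)%N%:Z by lia.
      move: (j %/ 5)%N (r %/ 5)%N (ltn_pmod j (isT : (0 < 5)%N)) (ltn_pmod r (isT : (0 < 5)%N)) => a b.
      by case: (j %% 5)%N => [|[|[|[|[|]]]]] // _; case: (r %% 5)%N => [|[|[|[|[|]]]]] // _ ex; exfalso; lia.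
    by apply: (@expz_mod _ 5) => //; lia.
  rewrite theta_split // -/al -/be.
  have -> : F * (al * A + be * B) = F * (al * A) + F * (be * B) by ring.
  rewrite componentD.
  have -> : component 5 4 (F * (al * A)) = F_ 4 * (al * A).
    rewrite -[4%N in LHS]addn0 component_mulr //; rewrite -[0%N]addn0.
    by apply: gradedM => //; apply: graded_const.
  have -> : component 5 4 (F * (be * B)) = F_ 3 * (be * B).
    rewrite -[4%N in LHS]/(3 + 1)%N component_mulr //; rewrite -[1%N]add0n.
    by apply: gradedM => //; apply: graded_const.
  by move=> <-; ring.
(* The components [F_ 0], [F_ 1] and [F_ 2] cancel in this combination. *)
have R : F_ 4 * A ^+ 6 + 2 * F_ 3 * A ^+ 5 * B - 2 * F_ 4 * A * B ^+ 5 + F_ 3 * B ^+ 6 = 0.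
  apply: (fps_mulf_eq0 _ E0_neq0).
  have g4 := @Gcomp 4 3 2 erefl erefl; have g3 := @Gcomp 3 2 1 erefl erefl.
  have g1 := @Gcomp 1 0 4 erefl erefl; have g0 := @Gcomp 0 4 3 erefl erefl.
  transitivity (A ^+ 2 * (G_ 4 * A ^+ 4 + G_ 3 * A ^+ 3 * B + G_ 1 * A * B ^+ 3 - G_ 0 * B ^+ 4)).
    transitivity ((A ^+ 2 * G_ 4) * A ^+ 4 + (A ^+ 2 * G_ 3) * A ^+ 3 * B
      + (A ^+ 2 * G_ 1) * A * B ^+ 3 - (A ^+ 2 * G_ 0) * B ^+ 4); last by ring.
    by rewrite g4 g3 g1 g0; ring.
  by rewrite lambert_relation mulr0.
have F3 : F_ 3 = 0.
  (* This factor is the determinant of the two equations divided by [A * B]. Its constant term is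
     [2 - 2 z + z^2 - z^4], since [A] starts with 1 and [B] has no constant term. *)
  apply: (fps_mulf_eq0 (f := (2 * al - be) * A ^+ 5 + (2 * be + al) * B ^+ 5)); last first.
    apply: fps_unit_neq0; rewrite fpsDE.
    have cm (f g : fps) : (f * g) 0%N = f 0%N * g 0%N by exact: fps_coef0M.
    have B0 : B 0%N = 0.
      by have [//|/gB] := eqVneq (B 0%N) 0.
    rewrite !exprS !cm A_coef0 B0 !(mulr1, mul0r, mulr0) addr0.
    have -> : 2 * al - be = al + al - be by ring.
    rewrite !fpsDE fpsNE /al /be /=.
    by have -> : 1 - z + (1 - z) - (z ^+ 4 - z ^+ 2) = 2 - 2 * z + z ^+ 2 - z ^+ 4 by ring.
  apply: (fps_mulf_eq0 _ B_neq0).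
  transitivity (al * (F_ 4 * A ^+ 6 + 2 * F_ 3 * A ^+ 5 * B - 2 * F_ 4 * A * B ^+ 5 + F_ 3 * B ^+ 6)
     - (A ^+ 5 - 2 * B ^+ 5) * (al * F_ 4 * A + be * F_ 3 * B)); first by ring.
  by rewrite R D4; ring.
split=> //; move: D4; rewrite F3 mulr0 mul0r addr0 mulrC mulrA => e.
apply: (fps_mulf_eq0 (f := A * al)) => //.
apply: fps_unit_neq0; rewrite fps_coef0M A_coef0 mul1r /=.
exact: z1.
Qed.

End Final.
End ModFive.

End Vanishing.

(** * Durfee rectangles and the pentagonal number theorem *)

Section QSeries.
Local Open Scope ring_scope.
Variable K : numFieldType.
Local Notation fps := (fps K).
Local Notation mono := (@mono K).

Definition tpow (e : nat) : fps := mono 1 e%:Z.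
Definition qpow (k : nat) : fps := tpow (6 * k).

Lemma tpow0 : tpow 0 = 1. Proof. exact: mono1. Qed.
Lemma tpowD a b : tpow (a + b) = tpow a * tpow b.
Proof. by rewrite /tpow monoM // mulr1 -PoszD. Qed.

Lemma qpow0 : qpow 0 = 1. Proof. by rewrite /qpow muln0 tpow0. Qed.
Lemma qpowD a b : qpow (a + b) = qpow a * qpow b.
Proof. by rewrite /qpow mulnDr tpowD. Qed.

Definition geo (k : nat) : fps := Sum (fun n : nat => qpow (k * n)).

Lemma smb_tpow (I : choiceType) (NI : normed I) (C : nat) (e : I -> nat) :
  (forall i, (nrm i <= e i + C)%N) -> smb (fun i => tpow (e i)).
Proof. by move=> ie; apply: (@smb_mono _ _ _ 1 C) => i _; have := ie i; lia. Qed.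

Lemma smb_tpowM (I : choiceType) (NI : normed I) (C : nat) (e : I -> nat) (g : I -> fps) :
  (forall i, (nrm i <= e i + C)%N) -> smb (fun i => tpow (e i) * g i).
Proof. by move=> ie; apply: (@smb_monoM _ _ _ 1 C) => i _; have := ie i; lia. Qed.

Lemma geoK k : (0 < k)%N -> (1 - qpow k) * geo k = 1.
Proof.
move=> k0; have sg : smb (fun n : nat => qpow (k * n)).
  by apply: (@smb_tpow _ _ 0) => n /=; nia.
rewrite mulrBl mul1r {1}/geo Sum_natS // muln0 qpow0 /geo Sum_mull //.
apply/eqP; rewrite -[X in _ == X]addr0 -addrA; apply/eqP; congr (_ + _).
apply/eqP; rewrite subr_eq0; apply/eqP; apply: eq_Sum => n.
by rewrite mulnS qpowD.
Qed.

(* [qp n] is (q)_n and [iq n] is its inverse. *)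
Definition qp (n : nat) : fps := \prod_(i < n) (1 - qpow i.+1).
Definition iq (n : nat) : fps := \prod_(i < n) geo i.+1.

Lemma qpS n : qp n.+1 = qp n * (1 - qpow n.+1). Proof. exact: big_ord_recr. Qed.
Lemma iqS n : iq n = (1 - qpow n.+1) * iq n.+1.
Proof. by rewrite /iq big_ord_recr /= mulrCA geoK // mulr1. Qed.
Lemma iqK n : qp n * iq n = 1.
Proof. by rewrite /qp /iq -big_split /= big1 // => i _; rewrite geoK. Qed.
Lemma iq0 : iq 0 = 1. Proof. exact: big_ord0. Qed.

Definition low (N : nat) (f : fps) := forall n, (n < N)%N -> f n = 0.

Lemma lowD N f g : low N f -> low N g -> low N (f + g).
Proof. by move=> lf lg n nN; rewrite fpsDE lf ?lg ?addr0. Qed.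

Lemma lowM N f g : low N f -> low N (f * g).
Proof.
move=> lf n nN; rewrite fpsME big1 // => i _; rewrite lf ?mul0r //.
by have := ltn_ord i; lia.
Qed.

Lemma low_tpow N e : (N <= e)%N -> low N (tpow e).
Proof. by move=> Ne n nN; rewrite /tpow /=; case: eqP => // ne; lia. Qed.

Lemma low_Sum N (I : choiceType) (f : I -> fps) : (forall i, low N (f i)) -> low N (Sum f).
Proof.
by move=> lf n nN; rewrite (@SumE _ _ _ [::]) ?big_nil // => i _; apply: lf.
Qed.

Lemma low_sum N (I : finType) (P : pred I) (f : I -> fps) :
  (forall i, P i -> low N (f i)) -> low N (\sum_(i | P i) f i).
Proof. by move=> lf n nN; rewrite fps_sumE big1 // => i Pi; apply: lf. Qed.

Definition durfee_term (a k : nat) : fps := qpow (k * (k + a)) * (iq k * iq (k + a)).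
(** Sorted by their Durfee rectangle of sides [k] and [k + a], all partitions are generated by this
    series, whatever [a] is. *)
Definition durfee (a : nat) : fps := Sum (durfee_term a).

Lemma smb_durfee a (g : nat -> fps) : smb (fun k : nat => qpow (k * (k + a)) * g k).
Proof. by apply: (@smb_tpowM _ _ 0) => k /=; nia. Qed.

(** Each term is split by [1 = (1 - q^k) + q^k], the first half is shifted by one in [k], and the
    halves recombine after [iq (k + a)] is written as [(1 - q^(k+a+1)) * iq (k + a).+1]. *)
Lemma durfeeS a : durfee a = durfee a.+1.
Proof.
pose f k := qpow (k * (k + a)) * ((1 - qpow k) * (iq k * iq (k + a))).
pose g k := qpow (k * (k + a)) * (qpow k * (iq k * iq (k + a))).
transitivity (Sum (fun k => f k + g k)).
  by apply: eq_Sum => k; rewrite /durfee_term /f /g; ring.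
have sf : smb f by exact: smb_durfee.
rewrite SumD //; last exact: smb_durfee.
rewrite (Sum_mono_nat0 sf); last by rewrite /f qpow0 subrr mul0r mulr0.
rewrite -SumD; last 2 first.
- by apply: smb_reindex sf; apply: succn_inj.
- exact: smb_durfee.
apply: eq_Sum => k; rewrite /f /g /durfee_term.
rewrite [X in _ + X](_ : _ = qpow (k * (k + a)) * qpow k *
  (iq k * ((1 - qpow (k + a).+1) * iq (k + a).+1))); last by rewrite -iqS; ring.
rewrite [in X in X + _](_ : (1 - qpow k.+1) * (iq k.+1 * iq (k.+1 + a)) =
  iq k * iq (k + a).+1); last first.
  by rewrite mulrA -iqS addSn.
have -> : qpow (k.+1 * (k.+1 + a)) = qpow (k * (k + a.+1)) * qpow (k + a).+1 by rewrite -qpowD; congr qpow; lia.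
have -> : qpow (k * (k + a)) * qpow k = qpow (k * (k + a.+1)) by rewrite -qpowD; congr qpow; lia.
by rewrite addnS; ring.
Qed.

Lemma durfee_const a : durfee a = durfee 0.
Proof. by elim: a => // a IHa; rewrite -durfeeS. Qed.

(** The term [k = 0] is [iq a] and all others have high order. With [durfee_const], letting [a] grow
    identifies the common value as 1 / (q)_oo. *)
Lemma low_durfee a : low (6 * a.+1) (durfee a - iq a).
Proof.
rewrite /durfee Sum_natS; last exact: smb_durfee.
rewrite {1}/durfee_term mul0n qpow0 mul1r iq0 mul1r add0n addrAC subrr add0r.
apply: low_Sum => k; apply: lowM; apply: low_tpow; nia.
Qed.

(* Shanks' finite form of the pentagonal number theorem. *)
Lemma shanks n :
  \sum_(s < n.+1) (-1) ^+ s * \prod_(s <= i < n) (1 - qpow i.+1) * tpow (6 * n * s + 3 * s * s.+1) =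
  1 + \sum_(k < n) (-1) ^+ k.+1 * (tpow (3 * k.+1 * (3 * k + 2)) + tpow (3 * k.+1 * (3 * k + 4))).
Proof.
elim: n => [|n IHn].
  by rewrite big_ord1 big_ord0 addr0 big_geq // expr0 !mul1r tpow0.
rewrite big_ord_recr /= big_geq // mulr1 [in RHS]big_ord_recr /= addrA -IHn.
set S := \sum_(s < n.+1) _; set S' := \sum_(s < n.+1) _.
pose W s := (-1) ^+ s * \prod_(s <= i < n) (1 - qpow i.+1) * tpow (6 * n * s + 3 * s * s.+1) : fps.
(* [U] telescopes the difference between consecutive values of [n]. It also equals
   [(1 - qpow s) * W s], hence the value 0 at [s = 0]. *)
pose U s := if s is s'.+1 then - (W s' * qpow (n.+1 + s')) else 0.
suff : S - S' = - ((-1) ^+ n * tpow (3 * n.+1 * (3 * n + 2))).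
  move/eqP; rewrite subr_eq => /eqP ->.
  have -> : tpow (6 * n.+1 * n.+1 + 3 * n.+1 * n.+2) = tpow (3 * n.+1 * (3 * n + 4)) by congr tpow; lia.
  by rewrite [(-1) ^+ n.+1]exprS; ring.
rewrite /S /S' -sumrB (eq_bigr (fun s : 'I_n.+1 => U s.+1 - U s)) => [|s _].
  rewrite -(big_mkord xpredT (fun s => U s.+1 - U s)) telescope_sumr // subr0 /= /W.
  rewrite big_geq // mulr1 -mulrA -tpowD; congr (- (_ * _)); congr tpow; lia.
have sn : (s < n.+1)%N := ltn_ord s.
rewrite big_nat_recr //= -/(W s).
have -> : tpow (6 * n.+1 * s + 3 * s * s.+1) = tpow (6 * n * s + 3 * s * s.+1) * qpow s.
  by rewrite /qpow -tpowD; congr tpow; lia.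
have Us : U s = (1 - qpow s) * W s.
  case: (nat_of_ord s) sn => [|s'] s'n; first by rewrite qpow0 subrr mul0r.
  rewrite /U /W [\prod_(s' <= i < n) _]big_ltn // exprS.
  have -> : tpow (6 * n * s'.+1 + 3 * s'.+1 * s'.+2) = tpow (6 * n * s' + 3 * s' * s'.+1) * qpow (n.+1 + s').
    by rewrite /qpow -tpowD; congr tpow; lia.
  by ring.
by rewrite Us /U /W qpowD; ring.
Qed.

End QSeries.

(** * The series [Eul] as the infinite product (q)_oo *)

Section EulerProduct.
Local Open Scope ring_scope.
Variable K : numFieldType.
Local Notation fps := (fps K).
Local Notation eps := (eps K).
Local Notation chi := (chi K).
Local Notation mono := (@mono K).
Local Notation Eul := (Eul K).
Local Notation tpow := (tpow K).
Local Notation qpow := (qpow K).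
Local Notation qp := (qp K).
Local Notation iq := (iq K).
Local Notation durfee := (durfee K).

Lemma smb_addn (n : nat) (f : nat -> fps) : smb f -> smb (fun k => f (k + n)%N).
Proof. by move=> sf; apply: smb_reindex sf; apply: addIn. Qed.

Lemma Sum_nat_split (n : nat) (f : nat -> fps) : smb f ->
  Sum f = \sum_(k < n) f k + Sum (fun k => f (k + n)%N).
Proof.
elim: n f => [|n IHn] f sf.
  by rewrite big_ord0 add0r; apply: eq_Sum => k; rewrite addn0.
rewrite (IHn f sf) (Sum_natS (smb_addn n sf)) big_ord_recr /= add0n addrA.
by congr (_ + _); apply: eq_Sum => k; rewrite addSnnS.
Qed.

Lemma eps_nat (n : nat) : eps n%:Z = (-1) ^+ n.
Proof.
elim: n => [|n IHn]; first by [].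
by rewrite exprS -IHn mulN1r; apply: epsNN; lia.
Qed.

Lemma EulE : Eul = Sum (fun k : int => mono (eps k) (3 * k * (3 * k + 1))).
Proof.
(* [h] enumerates the integers prime to 3, the support of [chi]: [2 m] goes to [3 m + 1], and
   [2 m - 1] to [2 - 3 m]. *)
pose h (k : int) : int := if (k %% 2)%Z == 0 then 3 * (k %/ 2)%Z + 1 else 2 - 3 * ((k + 1) %/ 2)%Z.
rewrite /Eul (@Sum_reindex _ _ _ h) => [|x y|n].
- apply: eq_Sum => k; rewrite /h /eps; case: eqP => k2.
    have -> : chi (3 * (k %/ 2)%Z + 1) = 1.
      by rewrite /chi; have -> : ((3 * (k %/ 2)%Z + 1) %% 3)%Z = 1 by lia.
    have [m ->] : exists m, k = 2 * m by exists (k %/ 2)%Z; lia.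
    rewrite (_ : (2 * m %/ 2)%Z = m); last by lia.
    congr (mono _ _); ring.
  have -> : chi (2 - 3 * ((k + 1) %/ 2)%Z) = -1.
    by rewrite /chi; have -> : ((2 - 3 * ((k + 1) %/ 2)%Z) %% 3)%Z = 2 by lia.
  have [m ->] : exists m, k = 2 * m - 1 by exists ((k + 1) %/ 2)%Z; lia.
  rewrite (_ : ((2 * m - 1 + 1) %/ 2)%Z = m); last by lia.
  congr (mono _ _); ring.
- by rewrite /h; do 2 case: eqP => ?; lia.
- have [c0|] := eqVneq (chi n) 0; first by rewrite c0 mono0 eqxx.
  move=> /chi_neq0 n3 _; rewrite /h.
  have [n1|n1] : (n %% 3)%Z = 1 \/ (n %% 3)%Z = 2 by lia.
    by exists (2 * (n %/ 3)%Z); case: eqP; lia.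
  by exists (- 2 * (n %/ 3)%Z - 1); case: eqP; lia.
Qed.

(** The terms of indices [k + 1] and [- (k + 1)] in the pentagonal series. *)
Definition pent (k : nat) : fps :=
  (-1) ^+ k.+1 * (tpow (3 * k.+1 * (3 * k + 2)) + tpow (3 * k.+1 * (3 * k + 4))).

Lemma smb_pent : smb pent.
Proof.
have -> : pent = fun k => tpow (3 * k.+1 * (3 * k + 2)) * (-1) ^+ k.+1 +
    tpow (3 * k.+1 * (3 * k + 4)) * (-1) ^+ k.+1.
  by apply/funext => k; rewrite /pent mulrC mulrDl.
by apply: smbD; apply: (@smb_tpowM _ _ _ 0) => k /=; nia.
Qed.

Lemma mono_sign (k : nat) (e : nat) : mono ((-1) ^+ k) e%:Z = (-1) ^+ k * tpow e.
Proof.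
elim: k => [|k IHk]; first by rewrite !expr0 mul1r.
by rewrite !exprS mulN1r monoN IHk mulN1r mulNr.
Qed.

Lemma Eul_pent : Eul = 1 + Sum pent.
Proof.
have sE : smb (fun k : int => mono (eps k) (3 * k * (3 * k + 1))).
  by apply: (@smb_mono _ _ _ 1 10) => k _ /=; have := abs_sqr k 4; nia.
rewrite EulE (Sum_int sE) (Sum_natS (f := fun n : nat => mono (eps (- n%:Z)) _)); last first.
  by apply: (smb_reindex _ sE) => x y /oppr_inj [].
rewrite oppr0 /= mulr0 mul0r (_ : eps 0 = 1) // mono1 addrCA; congr (_ + _).
rewrite -SumD; last 2 first.
- by apply: (smb_reindex _ sE) => x y [].
- by apply: (smb_reindex _ sE) => x y /oppr_inj [].
apply: eq_Sum => k; rewrite /pent addrC [in RHS]mulrDr -!mono_sign.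
congr (mono _ _ + mono _ _); try lia; rewrite -eps_nat; apply: eq_eps; lia.
Qed.

(** The term [s = 0] of Shanks' identity is [qp n]; the other terms, like the tail of the pentagonal
    series, have order at least [6 * n.+1]. *)
Lemma Eul_qp n : low (6 * n.+1) (Eul - qp n).
Proof.
pose A s := (-1) ^+ s * \prod_(s <= i < n) (1 - qpow i.+1) * tpow (6 * n * s + 3 * s * s.+1).
have qpE : qp n = 1 + \sum_(k < n) pent k - \sum_(s < n) A s.+1.
  rewrite /pent -shanks big_ord_recl /= -/(A) mul1r addn0 muln0 tpow0 mulr1 big_mkord.
  by rewrite /A addrK.
rewrite qpE Eul_pent (Sum_nat_split n smb_pent).
rewrite (_ : _ - _ = Sum (fun k => pent (k + n)) + \sum_(s < n) A s.+1); last by ring.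
apply: lowD.
  apply: low_Sum => k; rewrite /pent mulrC; apply: lowM; apply: lowD; apply: low_tpow; nia.
by apply: low_sum => s _; rewrite /A mulrC; apply: lowM; apply: low_tpow; nia.
Qed.

Lemma Eul_durfee : Eul * durfee 0 = 1.
Proof.
apply/eqP; rewrite -subr_eq0; apply/eqP; apply: fpsP => N; rewrite fps0E.
have -> : Eul * durfee 0 - 1 = (Eul - qp N) * durfee 0 + (durfee N - iq N) * qp N.
  by rewrite durfee_const -(iqK K N); ring.
by apply: (@lowD _ (6 * N.+1)); [apply: lowM; apply: Eul_qp|apply: lowM; apply: low_durfee|lia].
Qed.

End EulerProduct.

(** * The crank series and its diagonals *)

Section CrankFamily.
Local Open Scope ring_scope.
Variable K : numFieldType.
Local Notation fps := (fps K).
Local Notation chi := (chi K).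
Local Notation mono := (@mono K).
Local Notation Eul := (Eul K).
Local Notation tpow := (tpow K).
Local Notation qpow := (qpow K).
Local Notation iq := (iq K).
Local Notation geo := (geo K).
Local Notation durfee := (durfee K).
Local Notation gser := (gser K).

Definition crank_term (k m : nat) : fps :=
  qpow (k.+1 * m.+1) * (iq k * iq m * geo (k + m).+1).
Local Notation t := crank_term.

Lemma crank_termC k m : t k m = t m k.
Proof. by rewrite /t mulnC [iq k * _]mulrC addnC. Qed.

Definition crank_diag (d : nat) : fps := Sum (fun k : nat => t k (k + d)).
Local Notation u := crank_diag.

Lemma smb_diag d : smb (fun k : nat => t k (k + d)).
Proof. by apply: (@smb_tpowM _ _ _ 0) => k /=; nia. Qed.

(** The term [k] on the diagonal [d] and the term [k - 2] on the diagonal [d + 4] share the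
    denominator [1 - q^(2k+d+1)]. In their weighted difference it cancels, leaving a factor free of
    [k] times the term [k] of [durfee d.+2]. *)
Lemma crank_diag_rec d : u d - qpow (3 * d + 6) * u (d + 4) = (qpow d.+1 - qpow (2 * d + 3)) * durfee 0.
Proof.
pose s k := if k is k'.+2 then qpow (3 * d + 6) * t k' (k' + (d + 4)) else 0.
have ss : smb s.
  have s1 : smb (fun k => qpow (3 * d + 6) * t k (k + (d + 4))) by apply: smb_mull; apply: smb_diag.
  move=> N; have [r rP] := s1 N; exists [:: 0, 1 & map (addn 2) r] => -[|[|k]] //.
  rewrite !inE /= => kr; apply: rP; apply: contra kr => kr.
  exact: (map_f (addn 2) kr).
have -> : qpow (3 * d + 6) * u (d + 4) = Sum s.
  rewrite Sum_mono_nat0 // Sum_mono_nat0 //; last by apply: (smb_reindex _ ss); apply: succn_inj.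
  by rewrite Sum_mull //; apply: smb_diag.
rewrite -SumB //; last exact: smb_diag.
rewrite -(durfee_const _ d.+2) Sum_mull; last exact: smb_durfee.
apply: eq_Sum => k; rewrite /durfee_term.
(* A uniform formula: the factors [1 - qpow k.-1] and [1 - qpow k] make it vanish at [k = 0] and
   [k = 1], as [s] does. *)
have sE : s k = qpow (k * (k + d) + 2 * (k + d) + 3) * ((1 - qpow k.-1) * (1 - qpow k) * iq k) *
    (iq (k + d).+2 * geo (k + (k + d)).+1).
  case: k => [|[|k]]; rewrite /s /=.
  - by rewrite qpow0 subrr mulr0 !(mul0r, mulr0).
  - by rewrite qpow0 subrr !(mul0r, mulr0).
  rewrite {1}/t (iqS _ k) (iqS _ k.+1).
  have -> : qpow (k.+2 * (k.+2 + d) + 2 * (k.+2 + d) + 3) = qpow (3 * d + 6) * qpow (k.+1 * (k + (d + 4)).+1).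
    by rewrite -qpowD; congr qpow; lia.
  have -> : (k.+2 + d).+2 = (k + (d + 4))%N by lia.
  have -> : (k.+2 + (k.+2 + d)).+1 = (k + (k + (d + 4))).+1 by lia.
  ring.
rewrite sE /t (iqS _ (k + d)) (iqS _ (k + d).+1) (_ : iq (k + d.+2) = iq (k + d).+2); last by rewrite !addnS.
set w := iq (k + d).+2; set g := geo _; set v := iq k.
have gK : (1 - qpow (k + (k + d)).+1) * g = 1 by rewrite geoK.
have -> : (qpow d.+1 - qpow (2 * d + 3)) * (qpow (k * (k + d.+2)) * (v * w)) =
          (qpow d.+1 - qpow (2 * d + 3)) * (qpow (k * (k + d.+2)) * (v * w)) *
          ((1 - qpow (k + (k + d)).+1) * g).
  by rewrite gK mulr1.
rewrite /g /v /w; case: {sE gK w g v} k => [|k].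
  rewrite !mul0n !add0n qpow0 mul1n subrr mulr0 !(mul0r, mulr0) subr0.
  by rewrite (_ : 2 * d + 3 = d.+1 + d.+2)%N ?qpowD; [ring|lia].
(* In these monomials the claim becomes a polynomial identity. *)
pose x := qpow k; pose y := qpow d; pose q := qpow 1; pose z := qpow (k * k); pose zz := qpow (k * d).
have qpowS n : qpow n.+1 = q * qpow n by rewrite -add1n qpowD.
rewrite /=.
rewrite (_ : k.+2 * (k.+1 + d).+1 = k * k + k * d + k + k + k + k + d + d + 4)%N; last by lia.
rewrite (_ : k.+1 * (k.+1 + d) + 2 * (k.+1 + d) + 3 = k * k + k * d + k + k + k + k + d + d + d + 6)%N; last by lia.
rewrite (_ : k.+1 * (k.+1 + d.+2) = k * k + k * d + k + k + k + k + d + 3)%N; last by lia.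
rewrite (_ : k.+1 + (k.+1 + d) = k + k + d + 2)%N; last by lia.
rewrite (_ : 2 * d + 3 = d + d + 3)%N; last by lia.
rewrite !addnS !addSn !addn0. rewrite !qpowS !qpowD -/x -/y -/q -/z -/zz.
ring.
Qed.

(** As [chi] has period 3, the shift [n -> n + 3] carries the exponent at [d] to that at [d + 4], up
    to a constant. The right-hand side consists of the terms [n = 1] and [n = 2]. *)
Lemma gser_rec d : gser d - qpow (3 * d + 6) * gser (d + 4) = qpow d.+1 - qpow (2 * d + 3).
Proof.
pose f (n : nat) := mono (chi n%:Z) (4 * n%:Z ^+ 2 + 2 + 6 * n%:Z * d%:Z).
have sS (g : nat -> fps) : smb g -> smb (fun k : nat => g k.+1).
  by apply: smb_reindex; apply: succn_inj.
have s0 : smb f := smb_gser K d.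
have -> : gser d = f 0%N + (f 1%N + (f 2%N + Sum (fun n => f n.+3))).
  by rewrite [gser d](Sum_natS s0) (Sum_natS (sS _ s0)) (Sum_natS (sS _ (sS _ s0))).
have -> : f 0%N = 0 by rewrite /f (_ : chi 0%N = 0) ?mono0.
have -> : f 1%N = qpow d.+1.
  by rewrite /f (_ : chi 1%N = 1) // /qpow /tpow; congr (mono _ _); lia.
have -> : f 2%N = - qpow (2 * d + 3).
  by rewrite /f (_ : chi 2%N = -1) // monoN /qpow /tpow; congr (- mono _ _); lia.
suff -> : qpow (3 * d + 6) * gser (d + 4) = Sum (fun n => f n.+3) by ring.
rewrite Sum_mull; last exact: smb_gser.
apply: eq_Sum => n; rewrite /f /qpow /tpow monoM; [|lia|nia].
rewrite mul1r; congr (mono _ _); last by lia.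
by apply: eq_chi; lia.
Qed.

(** Both sides satisfy the same recurrence, by [Eul_durfee], and their orders grow with [d]. *)
Lemma Eul_diag d : Eul * u d = gser d.
Proof.
apply/eqP; rewrite -subr_eq0; apply/eqP.
pose x s := Eul * u (d + 4 * s) - gser (d + 4 * s).
have <- : x 0%N = Eul * u d - gser d by rewrite /x muln0 addn0.
apply: (@fps_recur_eq0 _ _ (fun s => qpow (3 * (d + 4 * s) + 6))) => s.
  rewrite /x (_ : d + 4 * s.+1 = d + 4 * s + 4)%N; last by lia.
  set e := (d + 4 * s)%N; apply/eqP; rewrite -subr_eq0; apply/eqP.
  transitivity (Eul * (u e - qpow (3 * e + 6) * u (e + 4)) - (gser e - qpow (3 * e + 6) * gser (e + 4))).
    by ring.
  by rewrite crank_diag_rec gser_rec mulrCA Eul_durfee; ring.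
move=> n ns; rewrite /x; have lt_n : (n < d + 4 * s)%N by lia.
rewrite fpsBE [(Eul * _)]mulrC; set e := (d + 4 * s)%N in lt_n *.
have -> : (u e * Eul) n = 0.
  apply: (@lowM _ e) => //; apply: low_Sum => k; apply: lowM; apply: low_tpow; nia.
rewrite sub0r (_ : gser e n = 0) ?oppr0 //.
apply: (@low_Sum _ e) => // m i ie; apply/eqP/negPn/negP => /mono_neq0P[/(Gfam_exp e%:Z)].
lia.
Qed.

Section CrankSeries.
Variable z : K.

Definition crank_family (p : nat * nat) : fps :=
  mono (z ^ (p.2%:Z - p.1%:Z)) 0 * t p.1 p.2.
Definition crank_series : fps := Sum crank_family.

Lemma smb_crank_family : smb crank_family.
Proof.
have -> : crank_family = fun p => qpow (p.1.+1 * p.2.+1) *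
    (mono (z ^ (p.2%:Z - p.1%:Z)) 0 * (iq p.1 * iq p.2 * geo (p.1 + p.2).+1)).
  by apply/funext => p; rewrite /crank_family /t mulrCA.
by apply: (@smb_tpowM _ _ _ 0) => -[k m] /=; nia.
Qed.

Lemma Eul_crank_series : z != 0 -> Eul * crank_series = Gser z.
Proof.
(* The pair [(k, m)] is encoded by [m - k] and the smaller of [k] and [m]. *)
move=> z0; pose h (p : int * nat) : nat * nat :=
  if 0 <= p.1 then (p.2, p.2 + absz p.1) else (p.2 + absz p.1, p.2).
have inj_h : injective h.
  by move=> [d k] [d' k']; rewrite /h /=; case: ifP => d0; case: ifP => d1 [] e1 e2; congr pair; lia.
rewrite /crank_series (Sum_reindex inj_h); last first.
  move=> [k m] _; have [km|mk] := leqP k m.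
    by exists (m%:Z - k%:Z, k); rewrite /h /=; case: ifP => ?; congr pair; lia.
  by exists (m%:Z - k%:Z, m); rewrite /h /=; case: ifP => ?; congr pair; lia.
have fE d k : crank_family (h (d, k)) = mono (z ^ d) 0 * t k (k + absz d).
  rewrite /h /=; case: ifP => d0; rewrite /crank_family /= ?[t (k + _) k]crank_termC.
    by congr (mono (z ^ _) _ * _); lia.
  by congr (mono (z ^ _) _ * _); lia.
rewrite Sum_pair; last by apply: smb_reindex smb_crank_family.
rewrite (GserE z0) Sum_mull; last first.
  by apply: (smb_pair (f := fun p => crank_family (h p))); apply: smb_reindex smb_crank_family.
apply: eq_Sum => d; rewrite -Eul_diag mulrCA; congr (_ * _).
rewrite [in RHS]Sum_mull; last exact: smb_diag.
by apply: eq_Sum => k; rewrite fE.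
Qed.

End CrankSeries.
End CrankFamily.

(** * Generating function of the paircrank *)

(** The length is added to the sum because a sequence may contain zeros. *)
#[export] Instance seq_normed : normed (seq nat).
Proof.
pose fix b M : seq (seq nat) := if M is M'.+1 then
  [::] :: [seq x :: l | x <- iota 0 M'.+1, l <- b M'] else [:: [::]].
exists (fun l => sumn l + size l) b.
elim=> [|M IHM] [|x l] //=; first by rewrite addnS.
move=> le_M; rewrite inE; apply/orP; right.
have xM : x \in iota 0 M.+1 by rewrite mem_iota; lia.
have lM : l \in b M by apply: IHM; lia.
exact: (allpairs_f (fun x l => x :: l) xM lM).
Defined.

Lemma path_leq_size s l : path leq s.+1 l -> size l <= sumn l.
Proof.
elim: l s => //= x l IHl s /andP[sx]; case: x sx => // x _ /IHl; lia.
Qed.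

Section CrankGeneratingFunction.
Local Open Scope ring_scope.
Variable K : numFieldType.
Local Notation fps := (fps K).
Local Notation mono := (@mono K).
Local Notation qpow := (qpow K).
Local Notation qp := (qp K).
Local Notation iq := (iq K).
Local Notation cst c := (mono c 0).

Lemma cstM (c d : K) : cst (c * d) = cst c * cst d.
Proof. by rewrite monoM ?addr0. Qed.

(** On the right [x s] only occurs multiplied by a series without constant term. The induction is on
    the coefficient, then on how far [s] is from exceeding it. *)
Lemma fps_recur_mul_eq0 (x c : nat -> fps) :
  (forall s, x s = x s.+1 + c s * x s) -> (forall s, c s 0%N = 0) ->
  (forall s n, (n < s)%N -> x s n = 0) -> forall s, x s = 0.
Proof.
move=> xc c0 x0 s; apply: fpsP => n; rewrite fps0E; elim/ltn_ind: n s => n IHn s.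
have [k] : exists k, (n < s + k)%N by exists n.+1; lia.
elim: k s => [|k IHk] s lt_n; first by apply: x0; lia.
rewrite xc fpsDE IHk ?add0r; last by lia.
rewrite fpsME big1 // => -[[|i] /= ltin] _; first by rewrite c0 mul0r.
by rewrite IHn ?mulr0 //; lia.
Qed.

Lemma qpow_coef0 k : qpow k.+1 0%N = 0.
Proof. by apply: (@low_tpow _ (6 * k.+1)) => //; lia. Qed.

Lemma smb_seq (P : pred (seq nat)) s (c : seq nat -> fps) :
  (forall l, P l -> path leq s.+1 l) ->
  smb (fun l => if P l then c l * qpow (sumn l) else 0).
Proof.
move=> Ps; apply: (@smb_nrm _ _ _ 1 0) => l n.
case: ifP => [/Ps/path_leq_size le_l|_]; last by rewrite fps0E eqxx.
move=> /fpsM_neq0P[i [j [<- _ /mono_neq0P[_]]]] /=; lia.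
Qed.

Lemma Sum_seq_split (s : nat) (f : seq nat -> fps) :
  smb (fun l => if path leq s l then f l else 0) ->
  Sum (fun l => if path leq s l then f l else 0) =
  Sum (fun l => if path leq s.+1 l then f l else 0) +
  Sum (fun l => if path leq s l then f (s :: l) else 0).
Proof.
(* The default head [s.+1] sends the empty sequence to the side that does not start with [s]. *)
move=> sf; rewrite (@Sum_partition _ _ 2 (fun l => head s.+1 l == s) _ sf); last first.
  by move=> l; case: eqP.
rewrite !big_ord_recl big_ord0 addr0 /=; congr (_ + _).
  apply: eq_Sum => -[|x l] /=; first by rewrite (_ : s.+1 == s = false) //; lia.
  by case: ltngtP.
rewrite (@Sum_reindex _ _ _ (cons s)) => [|l l' []//|[|x l] /=].
- by apply: eq_Sum => l /=; rewrite eqxx leqnn.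
- by rewrite (_ : s.+1 == s = false) ?eqxx //; lia.
- by case: (x =P s) => [->|_]; [exists l|rewrite eqxx].
Qed.

Section Argument.
Variable z : K.

Definition weight (b : nat) (l : seq nat) : fps := cst (z ^+ count (leq b) l) * qpow (sumn l).

Definition tails (s b : nat) : fps :=
  Sum (fun l => if path leq s l then weight b l else 0).

Lemma weight_cons b s l :
  weight b (s :: l) = cst (z ^+ (b <= s)%N) * qpow s * weight b l.
Proof. by rewrite /weight /= exprD cstM qpowD; ring. Qed.

Lemma smb_tails s b : smb (fun l => if path leq s.+1 l then weight b l else 0).
Proof. exact: (@smb_seq (path leq s.+1) s (fun l => cst (z ^+ count (leq b) l))). Qed.

Lemma tails_rec s b :
  tails s.+1 b = tails s.+2 b + cst (z ^+ (b <= s.+1)%N) * qpow s.+1 * tails s.+1 b.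
Proof.
rewrite {1}/tails Sum_seq_split; last exact: smb_tails.
congr (_ + _); rewrite /tails Sum_mull; last exact: smb_tails.
by apply: eq_Sum => l; rewrite weight_cons; case: ifP; rewrite ?mulr0.
Qed.

Lemma low_tails s b : low (6 * s.+1) (tails s.+1 b - 1).
Proof.
rewrite /tails (@Sum_partition _ _ 2 (fun l => l != [::])); last 2 first.
- exact: smb_tails.
- by case.
rewrite !big_ord_recl big_ord0 addr0 /= (@Sum_single _ _ [::]); last by case.
rewrite /= /weight /= expr0 mono1 qpow0 mul1r addrAC subrr add0r.
apply: low_Sum => -[|x l] //=; case: ifP => // /andP[sx _].
by rewrite /weight mulrC; apply: lowM; apply: low_tpow => /=; lia.
Qed.

(** Euler's expansion of [1 / (z q^s)_oo]. *)
Definition euler_sum (s : nat) : fps := Sum (fun m : nat => qpow (s * m) * (cst (z ^+ m) * iq m)).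

Lemma smb_euler_sum s (g : nat -> fps) : smb (fun m : nat => qpow (s.+1 * m) * g m).
Proof. by apply: (@smb_tpowM _ _ _ 0) => m /=; nia. Qed.

Lemma euler_sum_rec s : euler_sum s.+1 = euler_sum s.+2 + cst z * qpow s.+1 * euler_sum s.+1.
Proof.
pose f m := qpow (s.+1 * m) * (cst (z ^+ m) * ((1 - qpow m) * iq m)).
have sf : smb f by apply: smb_euler_sum.
have -> : cst z * qpow s.+1 * euler_sum s.+1 = Sum f.
  rewrite (Sum_mono_nat0 sf); last by rewrite /f qpow0 subrr mul0r !mulr0.
  rewrite /euler_sum Sum_mull; last exact: smb_euler_sum.
  apply: eq_Sum => m; rewrite /f -iqS mulnS qpowD exprS cstM; ring.
rewrite /euler_sum -SumD //; last exact: smb_euler_sum.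
apply: eq_Sum => m; rewrite /f (_ : qpow (s.+2 * m) = qpow (s.+1 * m) * qpow m); first by ring.
by rewrite -qpowD; congr qpow; lia.
Qed.

Lemma low_euler_sum s : low (6 * s.+1) (euler_sum s.+1 - 1).
Proof.
rewrite /euler_sum Sum_natS; last exact: smb_euler_sum.
rewrite muln0 qpow0 expr0 mono1 iq0 !mul1r addrAC subrr add0r.
by apply: low_Sum => m; apply: lowM; apply: low_tpow; nia.
Qed.

(** Every part carries a [z] here, so both sides satisfy the same recurrence in the lower bound, and
    both tend to 1 as it grows. *)
Lemma tails_low b s : (b <= s.+1)%N -> tails s.+1 b = euler_sum s.+1.
Proof.
move=> bs; apply/eqP; rewrite -subr_eq0; apply/eqP.
pose x r := tails (s + r).+1 b - euler_sum (s + r).+1.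
have <- : x 0%N = tails s.+1 b - euler_sum s.+1 by rewrite /x addn0.
apply: (@fps_recur_mul_eq0 _ (fun r => cst z * qpow (s + r).+1)) => r.
- rewrite {1}/x tails_rec euler_sum_rec /x addnS.
  have -> : (b <= (s + r).+1)%N by lia.
  by rewrite expr1; ring.
- by rewrite fps_coef0M qpow_coef0 mulr0.
- move=> n nr; rewrite /x (_ : _ - _ = tails (s + r).+1 b - 1 + (1 - euler_sum (s + r).+1)); last by ring.
  apply: (@lowD _ (6 * (s + r).+1)); [exact: low_tails| |lia].
  by move=> m lt_m; rewrite -opprB fpsNE (low_euler_sum lt_m) oppr0.
Qed.

(** The parts from [s.+1] to [s + k] carry no [z]; each factor of the product removes one of these
    part sizes. *)
Lemma tails_prod k s : (\prod_(i < k) (1 - qpow (s.+1 + i))) * tails s.+1 (s.+1 + k) = euler_sum (s.+1 + k).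
Proof.
elim: k s => [|k IHk] s; first by rewrite big_ord0 mul1r addn0 tails_low.
rewrite big_ord_recl addn0 -(addSnnS s.+1) -IHk mulrAC mulrC; congr (_ * _).
  by apply: eq_bigr => i _; rewrite /= /bump /= add1n addnS.
rewrite mulrBl mul1r [X in X - _]tails_rec.
have -> : (s.+2 + k <= s.+1)%N = false by lia.
by rewrite expr0 mono1 mul1r addrK.
Qed.
End Argument.

Definition box_pred (k a b : nat) (l : seq nat) : bool :=
  [&& path leq a l, all (ltn^~ b) l & size l == k].
Definition box (k a b : nat) : fps :=
  Sum (fun l => if box_pred k a b l then qpow (sumn l) else 0).

Lemma smb_box k a b : smb (fun l => if box_pred k a.+1 b l then qpow (sumn l) else 0).
Proof.
have := @smb_seq (box_pred k a.+1 b) a (fun => 1) _; rewrite /=.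
by under eq_fun do rewrite mul1r; apply=> l /and3P[].
Qed.

Lemma box0 a b : box 0 a b = 1.
Proof.
by rewrite /box (@Sum_single _ _ [::]) => [|[|x l] //]; rewrite ?qpow0 // /box_pred /= !andbF.
Qed.

Lemma box_empty k a : box k.+1 a a = 0.
Proof.
apply: Sum_eq0 => -[|x l]; rewrite /box_pred /= ?andbF //.
by rewrite [(x < a)%N]ltnNge; case: (a <= x)%N; rewrite //= andbF.
Qed.

Lemma box_rec k a b : (a < b)%N ->
  box k.+1 a.+1 b.+1 = box k.+1 a.+2 b.+1 + qpow a.+1 * box k a.+1 b.+1.
Proof.
move=> ab.
pose f l := if all (ltn^~ b.+1) l && (size l == k.+1) then qpow (sumn l) else 0.
have fE a' : (fun l => if path leq a' l then f l else 0) =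
    (fun l => if box_pred k.+1 a' b.+1 l then qpow (sumn l) else 0).
  by apply/funext => l; rewrite /f /box_pred; case: path.
rewrite /box -!fE Sum_seq_split; last by rewrite fE; apply: smb_box.
congr (_ + _); rewrite Sum_mull; last exact: smb_box.
apply: eq_Sum => l; rewrite /f /box_pred /= eqSS ltnS ab /= qpowD.
by case: path; case: all; case: eqP; rewrite /= ?mulr0.
Qed.

(** Up to a power of q, the box series is the Gaussian binomial coefficient of [k + w - 1] over [k];
    the inductions on [w] and [k] follow [box_rec]. *)
Lemma box_prod k a w :
  qp k * box k a.+1 (a.+1 + w) = qpow (a.+1 * k) * \prod_(i < k) (1 - qpow (w + i)).
Proof.
elim: w a k => [|w IHw] a k.
  case: k => [|k]; first by rewrite box0 /qp !big_ord0 muln0 qpow0.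
  by rewrite addn0 box_empty mulr0 big_ord_recl qpow0 subrr mul0r mulr0.
elim: k => [|k IHk]; first by rewrite box0 /qp !big_ord0 muln0 qpow0.
rewrite addnS box_rec ?leq_addr // mulrDr -addSn IHw addSn -addnS.
have -> : qp k.+1 * (qpow a.+1 * box k a.+1 (a.+1 + w.+1)) =
  qpow a.+1 * (1 - qpow k.+1) * (qp k * box k a.+1 (a.+1 + w.+1)) by rewrite qpS; ring.
rewrite IHk big_ord_recl addn0 [in RHS]big_ord_recr /=.
under eq_bigr => i _ do rewrite /bump /= add1n -addSnnS.
have -> : qpow (a.+2 * k.+1) = qpow (a.+1 * k) * qpow a.+1 * qpow k.+1 by rewrite -!qpowD; congr qpow; lia.
have -> : qpow (a.+1 * k.+1) = qpow (a.+1 * k) * qpow a.+1 by rewrite -qpowD; congr qpow; lia.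
have -> : qpow (w.+1 + k) = qpow w * qpow k.+1 by rewrite -qpowD; congr qpow; lia.
ring.
Qed.
End CrankGeneratingFunction.

Lemma path_last_lt b x l : path leq x l -> (last x l < b) = all (ltn^~ b) (x :: l).
Proof.
elim: l x => [|y l IHl] x /=; first by rewrite andbT.
move=> /andP[xy /IHl ->] /=; case: (ltnP y b) => [yb|_]; rewrite ?andbF //=.
by rewrite (leq_ltn_trans xy yb).
Qed.

Lemma path_gt0 s l : path leq s.+1 l -> all (fun k => 0 < k) l.
Proof.
move=> /(order_path_min leq_trans); apply: sub_all => k; exact: leq_trans.
Qed.

Lemma in_PPt_cons s l l' : in_PPt (s.+1 :: l, l') =
  path leq s.+1 l && (path leq s.+1 l' && all (ltn^~ (s.+1 + s.+1)) l').
Proof.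
rewrite /in_PPt /is_partition /=; case: (boolP (path leq s.+1 l)) => //= /path_gt0 -> /=.
case: l' => [|x l']; rewrite /lt_inf /largest /smallest ?ltnNge //= -ltnNge mul2n -addnn.
case: (boolP (path leq x l')) => [px|_]; rewrite /= ?andbF //.
rewrite (path_last_lt _ px); case: x px => [//|x] px.
by rewrite (path_gt0 px) /= andbT.
Qed.

Lemma in_PPtP p : in_PPt p -> exists s l, p = (s.+1 :: l, p.2).
Proof.
case: p => -[|[|s] l] l' /=; try by rewrite /in_PPt /is_partition //= ?andbF.
by move=> _; exists s, l.
Qed.

(** One formula for both cases: if [l'] is empty, all of [l] is counted and the head accounts for
    the subtracted 1; otherwise the head is too small to be counted. *)
Lemma paircrank_cons s l l' : path leq s.+1 l ->
  paircrank (s.+1 :: l, l') = ((count (leq (s.+1 + size l')) l)%:Z - (size l')%:Z)%R.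
Proof.
move=> /(order_path_min leq_trans); rewrite all_count => /eqP pl; rewrite /paircrank /=.
case: (size l') => [|k] /=; first by rewrite addn0 pl; lia.
rewrite (_ : (s.+1 + k.+1 <= s.+1) = false) ?add0n //; lia.
Qed.

(** * Summation over partition pairs *)

Section PairSeries.
Local Open Scope ring_scope.
Variable K : numFieldType.
Local Notation fps := (fps K).
Local Notation mono := (@mono K).
Local Notation tpow := (tpow K).
Local Notation qpow := (qpow K).
Local Notation qp := (qp K).
Local Notation iq := (iq K).
Local Notation geo := (geo K).
Local Notation cst c := (mono c 0).
Variable z : K.
Hypothesis z_neq0 : z != 0.

Definition pair_term (p : seq nat * seq nat) : fps :=
  if in_PPt p then cst (z ^ paircrank p) * qpow (sumn p.1 + sumn p.2) else 0.

Let idx := (nat * (nat * (seq nat * seq nat)))%type.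

(** [s.+1] is the smallest part of the first partition and [l] its remaining parts; [k] is the
    number of parts of the second partition [l']. *)
Definition slice_term (i : idx) : fps :=
  let: (s, (k, (l, l'))) := i in
  cst (z ^ (- k%:Z)) * qpow s.+1 *
  ((if path leq s.+1 l then weight z (s.+1 + k) l else 0) *
   (if box_pred k s.+1 (s.+1 + s.+1) l' then qpow (sumn l') else 0)).

Lemma slice_termE s l l' : slice_term (s, (size l', (l, l'))) = pair_term (s.+1 :: l, l').
Proof.
rewrite /slice_term /pair_term in_PPt_cons /box_pred eqxx andbT.
case: (boolP (path leq s.+1 l)) => [pl|_]; last by rewrite mul0r mulr0.
case: ifP => _; rewrite /= ?mulr0 //.
rewrite paircrank_cons // expfzDr // cstM /weight !qpowD exprnP; ring.
Qed.

Lemma smb_slice : smb slice_term.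
Proof.
apply: (@smb_nrm _ _ _ 1 0) => -[s [k [l l']]] n.
rewrite /slice_term; case: ifP => [pl|_]; last by rewrite mul0r mulr0 fps0E eqxx.
case: ifP => [/and3P[pl' _ /eqP <-]|_]; last by rewrite !mulr0 fps0E eqxx.
rewrite /weight mulrA => /fpsM_neq0P[i [j [<-]]].
move=> /fpsM_neq0P[i1 [i2 [<- /fpsM_neq0P[i3 [i4 [<- _ /mono_neq0P[_ e4]]]]]]].
move=> /fpsM_neq0P[i5 [i6 [<- _ /mono_neq0P[_ e6]]]] /mono_neq0P[_ e7] /=.
have := path_leq_size pl; have := path_leq_size pl'; lia.
Qed.

(** Since the parts of the second partition lie below twice the smallest part, the box has width
    [s.+1], and the product in [box_prod] is exactly the one absorbed by [tails_prod]. *)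
Lemma slice_prod k s :
  tails z s.+1 (s.+1 + k) * box K k s.+1 (s.+1 + s.+1) =
  qpow (s.+1 * k) * iq k * euler_sum z (s.+1 + k).
Proof.
have -> : box K k s.+1 (s.+1 + s.+1) = iq k * (qp k * box K k s.+1 (s.+1 + s.+1)).
  by rewrite mulrA [iq k * _]mulrC iqK mul1r.
rewrite box_prod -tails_prod; ring.
Qed.

Definition triple_term (i : nat * (nat * nat)) : fps :=
  let: (s, (k, m)) := i in
  qpow (s.+1 + s.+1 * k + (s.+1 + k) * m) * (cst (z ^ (m%:Z - k%:Z)) * (iq k * iq m)).

Lemma smb_triple : smb triple_term.
Proof.
have -> : triple_term = fun i => qpow (i.1.+1 + i.1.+1 * i.2.1 + (i.1.+1 + i.2.1) * i.2.2) *
  (cst (z ^ (i.2.2%:Z - i.2.1%:Z)) * (iq i.2.1 * iq i.2.2)).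
  by apply/funext => -[s [k m]].
apply: (@smb_tpowM _ _ _ 0) => -[s [k m]] /=; nia.
Qed.

Lemma Sum_slice : Sum slice_term = Sum triple_term.
Proof.
rewrite Sum_pair; last exact: smb_slice.
rewrite Sum_pair; last exact: smb_triple.
apply: eq_Sum => s; rewrite Sum_pair; last exact: smb_row smb_slice.
rewrite Sum_pair; last exact: smb_row smb_triple.
apply: eq_Sum => k; rewrite /slice_term.
pose a l := if path leq s.+1 l then weight z (s.+1 + k) l else 0.
pose b l := if box_pred k s.+1 (s.+1 + s.+1) l then qpow (sumn l) else 0.
have sa : smb a by exact: smb_tails.
have sb : smb b by exact: smb_box.
transitivity (Sum (fun j => cst (z ^ (- k%:Z)) * qpow s.+1 * (a j.1 * b j.2))).
  by apply: eq_Sum => -[l l'].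
rewrite -Sum_mull; last exact: smb_prod.
rewrite -(Sum_prod sa sb) [Sum a * Sum b]slice_prod.
rewrite /euler_sum mulrA Sum_mull; last by rewrite addSn; exact: smb_euler_sum.
apply: eq_Sum => m; rewrite /triple_term expfzDr // cstM !qpowD exprnP; ring.
Qed.

(** The exponent is [(k + 1) (m + 1) + (k + m + 1) s], so the sum over [s] is a geometric series. *)
Lemma Sum_triple : Sum triple_term = crank_series z.
Proof.
pose h (i : (nat * nat) * nat) := (i.2, i.1) : nat * (nat * nat).
rewrite (@Sum_reindex _ _ _ h) => [|[[? ?] ?] [[? ?] ?] [-> -> ->] //|[s j] _]; last by exists (j, s).
rewrite Sum_pair; last by apply: (smb_reindex _ smb_triple) => -[[? ?] ?] [[? ?] ?] [-> -> ->].
apply: eq_Sum => -[k m]; rewrite /crank_family /crank_term /=.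
have -> : qpow (k.+1 * m.+1) = qpow (k * m) * qpow (k + m).+1 by rewrite -qpowD; congr qpow; lia.
have sg : smb (fun n => qpow ((k + m).+1 * n)) by apply: (@smb_tpow _ _ _ 0) => n /=; nia.
transitivity (cst (z ^ (m%:Z - k%:Z)) * (qpow (k * m) * qpow (k + m).+1 * (iq k * iq m)) *
  geo (k + m).+1); last by ring.
rewrite /geo Sum_mull //; apply: eq_Sum => s; rewrite /triple_term /h /=.
have -> : qpow (s.+1 + s.+1 * k + (s.+1 + k) * m) = qpow (k * m) * qpow (k + m).+1 * qpow ((k + m).+1 * s).
  by rewrite -!qpowD; congr qpow; lia.
ring.
Qed.

Lemma Sum_pair_term : Sum pair_term = crank_series z.
Proof.
rewrite -Sum_triple -Sum_slice.
rewrite (@Sum_reindex _ _ _ (fun i : nat * (seq nat * seq nat) => (i.1.+1 :: i.2.1, i.2.2))).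
- rewrite (@Sum_reindex _ _ _ (fun i : nat * (seq nat * seq nat) => (i.1, (size i.2.2, i.2)))).
  + by apply: eq_Sum => -[s [l l']]; rewrite slice_termE.
  + by move=> [s [l l']] [r [j j']] [-> _ -> ->].
  + move=> [s [k [l l']]]; have [<-|lk] := eqVneq (size l') k; first by exists (s, (l, l')).
    by rewrite /slice_term /box_pred (negPf lk) !andbF !mulr0 eqxx.
- by move=> [s [l l']] [r [j j']] [-> -> ->].
- move=> p; rewrite /pair_term; case: ifP => [/in_PPtP[s [l ->]] _|_ /eqP //].
  by exists (s, (l, p.2)).
Qed.

Lemma crank_series_coef N :
  crank_series z (6 * N) = \sum_(p <- PPt_pairs N) z ^ paircrank p.
Proof.
have pE p : pair_term p (6 * N) = if in_PPt p && (sumn p.1 + sumn p.2 == N) then z ^ paircrank p else 0.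
  rewrite /pair_term; case: (in_PPt p); last by [].
  rewrite andTb /qpow /tpow monoM // mulr1 add0r /=.
  by rewrite (_ : ((6 * N)%N%:Z == (6 * (sumn p.1 + sumn p.2))%N%:Z) =
    (sumn p.1 + sumn p.2 == N)) //; apply/eqP/eqP; lia.
have PE p : (p \in PPt_pairs N) = in_PPt p && (sumn p.1 + sumn p.2 == N).
  rewrite mem_PPt_pairs /is_pair_of /in_PPt; case: is_partition => //=; case: is_partition => //=.
  by rewrite andbC.
rewrite -Sum_pair_term (SumE (uniq_PPt_pairs N)) => [|p]; last by rewrite pE PE => /negPf ->.
by rewrite !big_seq; apply: eq_bigr => p; rewrite pE PE => ->.
Qed.

End PairSeries.

(** * Equidistribution *)

Section Equidistribution.
Local Open Scope ring_scope.

(** Subtracting [a p.-1] times [1 + z + ... + z^(p-1) = 0] leaves a rational polynomial of degree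
    less than [p - 1], the degree of the minimal polynomial of [z]; hence it is 0. *)
Lemma prim_root_int_rel (p : nat) (z : algC) (a : nat -> int) : prime p -> p.-primitive_root z ->
  \sum_(i < p) (a i)%:~R * z ^+ i = 0 -> forall i, (i < p)%N -> a i = a p.-1.
Proof.
move=> pr_p prim_z rel i lt_ip; have p1 := prime_gt1 pr_p.
have z1 : z != 1 by rewrite -(prim_order_dvd prim_z 1) dvdn1; lia.
have [q [zq _] rootE] := minCpolyP z.
have size_q : size q = p.
  have := congr1 (fun r : {poly algC} => size r) zq.
  rewrite (minCpoly_cyclotomic prim_z) size_cyclotomic totient_prime //.
  by rewrite size_map_poly => <-; lia.
pose P : {poly rat} := \poly_(i < p) (a i - a p.-1)%:~R.
have root_P : root (map_poly ratr P) z.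
  rewrite /root (_ : map_poly ratr P = \poly_(i < p) (a i - a p.-1)%:~R); last first.
    apply/polyP => j; rewrite coef_map !coef_poly /=; case: ifP => _; last by rewrite rmorph0.
    by rewrite rmorph_int.
  rewrite horner_poly.
  under eq_bigr => j _ do rewrite rmorphB mulrBl.
  rewrite sumrB /= rel sub0r -mulr_sumr oppr_eq0 mulf_eq0; apply/orP; right.
  have : (1 - z) * \sum_(i < p) z ^+ i == 0.
    by rewrite -opprB mulNr -subrX1 (prim_expr_order prim_z) subrr oppr0.
  by rewrite mulf_eq0 subr_eq0 eq_sym (negPf z1).
have P0 : P = 0.
  apply/eqP; apply: contraLR root_P => P0; rewrite rootE gtNdvdp // size_q.
  apply: (@leq_ltn_trans p.-1); last by lia.
  apply/leq_sizeP => j le_j; rewrite coef_poly; case: ifP => // lt_j.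
  by rewrite (_ : j = p.-1) ?subrr //; lia.
have := congr1 (fun r : {poly rat} => r`_i) P0; rewrite coef_poly lt_ip coef0.
by move/eqP; rewrite intr_eq0 subr_eq0 => /eqP.
Qed.

Lemma sum_paircrank (p N : nat) (z : algC) : (0 < p)%N -> z != 0 -> z ^+ p = 1 ->
  \sum_(c <- PPt_pairs N) z ^ paircrank c = \sum_(r < p) (PPt_count p r%:Z N)%:Z%:~R * z ^+ r.
Proof.
move=> p0 z0 zp; under [RHS]eq_bigr => r _.
  rewrite /PPt_count -sum1_count -[_%:~R]/(_%:R) natr_sum mulr_suml; over.
rewrite /= (exchange_big_dep xpredT) //= !big_seq; apply: eq_bigr => c _.
have pZ : p%:Z != 0 by lia.
have cE : (absz (paircrank c %% p%:Z)%Z)%:Z = (paircrank c %% p%:Z)%Z by rewrite gez0_abs ?modz_ge0.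
have cp : ((absz (paircrank c %% p%:Z)%Z) < p)%N by rewrite -ltz_nat cE ltz_pmod.
rewrite (big_pred1 (Ordinal cp)) => [|r].
  by rewrite mul1r [_ ^+ _]exprnP; apply: (expz_mod z0 zp); rewrite /= cE modz_mod.
by rewrite /= -val_eqE /= -eqz_nat cE eq_sym (@modz_small r%:Z) ?ltz_nat ?ltn_ord.
Qed.

Lemma prim_root_prop (p : nat) (z : algC) : (1 < p)%N -> p.-primitive_root z ->
  [/\ z != 0, z != 1 & z ^+ p = 1].
Proof.
move=> p1 prim_z; have zp := prim_expr_order prim_z; split=> //.
  apply/eqP => z0; move: zp; rewrite z0 expr0n (gtn_eqF (ltnW p1)) => /eqP.
  by rewrite eq_sym oner_eq0.
by rewrite -(prim_order_dvd prim_z 1) dvdn1; lia.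
Qed.

Lemma equidistributed (p N : nat) : prime p ->
  (forall z : algC, p.-primitive_root z -> crank_series z (6 * N)%N = 0) ->
  forall r r' : int, PPt_count p r N = PPt_count p r' N.
Proof.
move=> pr_p F0; have p1 := prime_gt1 pr_p; have p0 := ltnW p1.
suff cE r : PPt_count p r N = PPt_count p p.-1%:Z N by move=> r r'; rewrite !cE.
have [z prim_z] := C_prim_root_exists p0.
have [z0 _ zp] := prim_root_prop p1 prim_z.
have := F0 z prim_z; rewrite (crank_series_coef z0) (sum_paircrank _ p0 z0 zp).
move/(prim_root_int_rel (a := fun r => (PPt_count p r%:Z N)%:Z) pr_p prim_z) => cE.
have pZ : p%:Z != 0 by lia.
have rE : (absz (r %% p%:Z)%Z)%:Z = (r %% p%:Z)%Z by rewrite gez0_abs ?modz_ge0.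
have lt_rp : (absz (r %% p%:Z)%Z < p)%N by rewrite -ltz_nat rE ltz_pmod.
move/eqP: (cE _ lt_rp); rewrite eqz_nat => /eqP <-.
by apply: eq_count => c; rewrite rE modz_mod.
Qed.

Lemma crank_series_mod3 (n : nat) (z : algC) : 3.-primitive_root z ->
  crank_series z (6 * (3 * n + 2))%N = 0.
Proof.
move=> prim_z; have [//|z0 z1 z3] := prim_root_prop _ prim_z.
exact: vanish_mod3 _ z0 z1 z3 (Eul_crank_series z0).
Qed.

Lemma crank_series_mod5 (n : nat) (z : algC) : 5.-primitive_root z ->
  crank_series z (6 * (5 * n + 3))%N = 0 /\ crank_series z (6 * (5 * n + 4))%N = 0.
Proof.
move=> prim_z; have [//|z0 z1 z5] := prim_root_prop _ prim_z.
have [||F3 F4] := vanish_mod5 z0 z5 (Eul_crank_series z0).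
- by rewrite subr_eq0 eq_sym.
(* The vanishing of [2 - 2 z + z^2 - z^4] would force the coefficients 2 and -1 to be equal. *)
- apply/eqP => rel.
  pose a i : int := nth 0 [:: 2; -2; 1; 0; -1] i.
  have := @prim_root_int_rel 5 z a isT prim_z _ 0%N isT; rewrite /a /=.
  suff E : \sum_(i < 5) (a i)%:~R * z ^+ i = 0 by move/(_ E).
  by rewrite -[RHS]rel !big_ord_recr big_ord0 /a /=; ring.
have {}F3 := congr1 (fun f : fps algC => f (6 * (5 * n + 3))%N) F3.
have {}F4 := congr1 (fun f : fps algC => f (6 * (5 * n + 4))%N) F4.
move: F3 F4; rewrite !componentE.
by rewrite (_ : _ == _) 1?(_ : (6 * (5 * n + 4)) %% 5 == 4 %% 5)%N //; apply/eqP; lia.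
Qed.

End Equidistribution.

Theorem theorem1p4 (n : nat) :
  [/\ forall r r' : int, PPt_count 3 r (3 * n + 2) = PPt_count 3 r' (3 * n + 2),
      forall r r' : int, PPt_count 5 r (5 * n + 3) = PPt_count 5 r' (5 * n + 3) &
      forall r r' : int, PPt_count 5 r (5 * n + 4) = PPt_count 5 r' (5 * n + 4)].
Proof.
split; apply: equidistributed => // z prim_z.
- exact: crank_series_mod3.
- by have [] := crank_series_mod5 n prim_z.
- by have [] := crank_series_mod5 n prim_z.
Qed.
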